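(* Let $\overline{\Sigma}$ be a closed oriented surface of genus $g>0$, let $\Sigma=\overline{\Sigma}\setminus\{v_1,\dots,v_s\}$ with $s>0$, let $N$ be odd, let $q\in\mathbb{C}^*$ be a primitive $N$-th root of unity, and let $\lambda$ be an ideal triangulation of $\Sigma$ with edges $\lambda_1,\dots,\lambda_n$, $n=6g-6+3s$. Let $\rho:\mathcal{T}_q(\lambda)\to \mathrm{End}(V)$ be a local representation of the Chekhov-Fock algebra $\mathcal{T}_q(\lambda)$ classified by weights $x_j\in\mathbb{C}^*$ associated to the edges $\lambda_j$ and a choice of $N$-th root $c=(x_1\cdots x_n)^{1/N}$. Then $\rho$ decomposes as a direct sum $$\rho=\bigoplus_{i\in\mathcal{I}}\rho^{(i)},$$ where each $\rho^{(i)}$ is an irreducible representation of $\mathcal{T}_q(\lambda)$ classified by the same edge weights $x_j$, by an $N$-th root $p_j^{(i)}=(x_1^{k_{j_1}}\cdots x_n^{k_{j_n}})^{1/N}$ associated to each puncture $v_j$, and by the same $c$. Moreover, given a choice of $N$-th root $p_j=(x_1^{k_{j_1}}\cdots x_n^{k_{j_n}})^{1/N}$ for each puncture $v_j$ such that $p_1\cdots p_s=c^2$, there exist exactly $N^g$ elements $i\in\mathcal{I}$ with $p_j^{(i)}=p_j$ for all $j\in\{1,\dots,s\}$.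
   Context: An ideal triangulation $\lambda$ of $\Sigma$ is a triangulation of $\overline{\Sigma}$ whose vertices are exactly $v_1,\dots,v_s$; it has $n=6g-6+3s$ edges and $m=4g-4+2s$ faces. (The same definitions below apply to a surface with punctures on its boundary, such as a triangle with three punctures at its corners.) Fock matrix: $\sigma_{ij}=a_{ij}-a_{ji}$, where $a_{ij}$ is the number of angular sectors delimited by $\lambda_i$ and $\lambda_j$ in the faces of $\lambda$ with $\lambda_i$ coming before $\lambda_j$ counterclockwise. The Chekhov-Fock algebra $\mathcal{T}_q(\lambda)$ is the $\mathbb{C}$-algebra generated by $X_1^{\pm1},\dots,X_n^{\pm1}$ with relations $X_iX_j=q^{2\sigma_{ij}}X_jX_i$. For $\mathbf{k}\in\mathbb{Z}^n$ the Weyl ordering is $[X_1^{k_1}\cdots X_n^{k_n}]:=q^{-\sum_{i<j}k_ik_j\sigma_{ij}}X_1^{k_1}\cdots X_n^{k_n}$, which is independent of the order of the factors. Let $H=[X_1\cdots X_n]$. For each puncture $v_j$, let $k_{j_i}$ be the minimum number of intersections of $\lambda_i$ with a small simple closed loop around $v_j$; the puncture invariant is $P_j=[X_1^{k_{j_1}}\cdots X_n^{k_{j_n}}]$. One has $[P_1\cdots P_s]=[H^2]$. Representations are finite dimensional complex representations. The irreducible representation of $\mathcal{T}_q(\lambda)$ classified by $x_j$, $p_j$, $c$ is the (unique up to isomorphism) irreducible representation with $X_j^N\mapsto x_j\,\mathrm{Id}$ for each edge, $P_j\mapsto p_j\,\mathrm{Id}$ for each puncture, and $H\mapsto c\,\mathrm{Id}$;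 it has dimension $N^{3g-3+s}$. Triangle algebra: the algebra $\mathcal{T}$ generated by $X_i^{\pm1}$, $i\in\mathbb{Z}/3$, with relations $X_iX_{i+1}=q^2X_{i+1}X_i$ (the Chekhov-Fock algebra of a single triangle, the generators corresponding to its three sides, cyclically labeled compatibly with the Fock matrix). If $T_1,\dots,T_m$ are the faces of $\lambda$ with triangle algebras $\mathcal{T}_1,\dots,\mathcal{T}_m$, there is an embedding $\iota:\mathcal{T}_q(\lambda)\to\mathcal{T}_1\otimes\cdots\otimes\mathcal{T}_m$ sending $X_i$ to $X_{j_i}\otimes X_{k_i}$ (generators associated to $\lambda_i$ in the two faces $T_j\ne T_k$ containing it, identity in the other factors), or to the Weyl ordered product $[X_{j_{i_1}}X_{j_{i_2}}]$ in $\mathcal{T}_j$ if $\lambda_i$ corresponds to two sides of the same face $T_j$. A local representation of $\mathcal{T}_q(\lambda)$ is a representation of the form $(\rho_1\otimes\cdots\otimes\rho_m)\circ\iota$ with each $\rho_i$ an irreducible representation of $\mathcal{T}_i$; it has dimension $N^{4g-4+2s}$. The local representation classified by $x_j$ and $c$ is the (unique up to isomorphism) local representation with $X_j^N\mapsto x_j\,\mathrm{Id}$ for each edge and $H\mapsto c\,\mathrm{Id}$. *)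

(* Defs.v *)
From HB Require Import structures.
From mathcomp Require Import all_boot all_order all_algebra.
From mathcomp Require Import boolp reals complex.

Set Implicit Arguments.
Unset Strict Implicit.
Unset Printing Implicit Defensive.

Import Order.TTheory GRing.Theory Num.Theory.
Local Open Scope ring_scope.
Local Open Scope quotient_scope.

(* The K-algebra presented by generators I and relations [rels]: formal       *)
(* expressions in the generators, modulo the least congruence containing      *)
(* [rels] and the axioms of associative unital K-algebras ([PScal a] is the   *)
(* scalar a times the unit).                                                  *)
Inductive pres_expr (K I : Type) : Type :=
| PGen of I
| PScal of K
| PAdd of pres_expr K I & pres_expr K I
| PMul of pres_expr K I & pres_expr K I.
Arguments PGen {K I}.
Arguments PScal {K I}.

HB.instance Definition _ (K I : Type) := gen_eqMixin (pres_expr K I).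
HB.instance Definition _ (K I : Type) := gen_choiceMixin (pres_expr K I).

Section PresentedAlgebra.
Variables (K : fieldType) (I : Type).
Variable rels : pres_expr K I -> pres_expr K I -> Prop.

Inductive pres_cong : pres_expr K I -> pres_expr K I -> Prop :=
| cong_refl t : pres_cong t t
| cong_sym t u : pres_cong t u -> pres_cong u t
| cong_trans t u v : pres_cong t u -> pres_cong u v -> pres_cong t v
| cong_add t t' u u' :
    pres_cong t t' -> pres_cong u u' -> pres_cong (PAdd t u) (PAdd t' u')
| cong_mul t t' u u' :
    pres_cong t t' -> pres_cong u u' -> pres_cong (PMul t u) (PMul t' u')
| cong_addA t u v : pres_cong (PAdd t (PAdd u v)) (PAdd (PAdd t u) v)
| cong_addC t u : pres_cong (PAdd t u) (PAdd u t)
| cong_add0 t : pres_cong (PAdd (PScal 0) t) t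
| cong_addN t : pres_cong (PAdd (PMul (PScal (-1)) t) t) (PScal 0)
| cong_mulA t u v : pres_cong (PMul t (PMul u v)) (PMul (PMul t u) v)
| cong_mul1l t : pres_cong (PMul (PScal 1) t) t
| cong_mul1r t : pres_cong (PMul t (PScal 1)) t
| cong_mulDl t u v :
    pres_cong (PMul (PAdd t u) v) (PAdd (PMul t v) (PMul u v))
| cong_mulDr t u v :
    pres_cong (PMul t (PAdd u v)) (PAdd (PMul t u) (PMul t v))
| cong_scalD a b : pres_cong (PScal (a + b)) (PAdd (PScal a) (PScal b))
| cong_scalM a b : pres_cong (PScal (a * b)) (PMul (PScal a) (PScal b))
| cong_scalC a t : pres_cong (PMul (PScal a) t) (PMul t (PScal a))
| cong_rel t u : rels t u -> pres_cong t u.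

Definition pres_congb : rel (pres_expr K I) := fun t u => `[< pres_cong t u >].

Lemma pres_congb_refl : reflexive pres_congb.
Proof. by move=> t; apply/asboolP; apply: cong_refl. Qed.

Lemma pres_congb_sym : symmetric pres_congb.
Proof. by move=> t u; apply/asboolP/asboolP; apply: cong_sym. Qed.

Lemma pres_congb_trans : transitive pres_congb.
Proof.
by move=> u t v /asboolP tu /asboolP uv; apply/asboolP; apply: cong_trans uv.
Qed.

Canonical pres_equiv :=
  EquivRel pres_congb pres_congb_refl pres_congb_sym pres_congb_trans.

Definition presented_algebra := {eq_quot pres_equiv}.
Local Notation A := presented_algebra.

HB.instance Definition _ := Choice.on A.
HB.instance Definition _ := EqQuotient.on A.

Definition pres_class (t : pres_expr K I) : A := \pi_A t.

Lemma pres_classP t u : pres_class t = pres_class u <-> pres_cong t u.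
Proof.
split=> [/eqmodP/asboolP // | tu]; apply/eqmodP; exact/asboolP.
Qed.

Lemma pres_classK (x : A) : pres_class (repr x) = x.
Proof. exact: reprK. Qed.

Lemma repr_class t : pres_cong (repr (pres_class t)) t.
Proof. by apply/pres_classP; rewrite pres_classK. Qed.

Definition pres_add (x y : A) : A := pres_class (PAdd (repr x) (repr y)).
Definition pres_mul (x y : A) : A := pres_class (PMul (repr x) (repr y)).
Definition pres_opp (x : A) : A := pres_class (PMul (PScal (-1)) (repr x)).
Definition pres_scale (a : K) (x : A) : A :=
  pres_class (PMul (PScal a) (repr x)).

Lemma pres_addE t u :
  pres_add (pres_class t) (pres_class u) = pres_class (PAdd t u).
Proof. by apply/pres_classP; apply: cong_add; apply: repr_class. Qed.

Lemma pres_mulE t u :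
  pres_mul (pres_class t) (pres_class u) = pres_class (PMul t u).
Proof. by apply/pres_classP; apply: cong_mul; apply: repr_class. Qed.

Lemma pres_oppE t :
  pres_opp (pres_class t) = pres_class (PMul (PScal (-1)) t).
Proof.
by apply/pres_classP; apply: cong_mul; [apply: cong_refl|apply: repr_class].
Qed.

Lemma pres_scaleE a t :
  pres_scale a (pres_class t) = pres_class (PMul (PScal a) t).
Proof.
by apply/pres_classP; apply: cong_mul; [apply: cong_refl|apply: repr_class].
Qed.

Let presE := (pres_addE, pres_mulE, pres_oppE, pres_scaleE).

Ltac lift1 := let t := fresh "t" in
  move=> t; rewrite -(pres_classK t); move: (repr t) => {}t.
Ltac by_cong c := rewrite ?presE; apply/pres_classP; apply: c.

Fact pres_addA : associative pres_add.
Proof. by do 3!lift1; by_cong cong_addA. Qed.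
Fact pres_addC : commutative pres_add.
Proof. by do 2!lift1; by_cong cong_addC. Qed.
Fact pres_add0 : left_id (pres_class (PScal 0)) pres_add.
Proof. by lift1; by_cong cong_add0. Qed.
Fact pres_addN : left_inverse (pres_class (PScal 0)) pres_opp pres_add.
Proof. by lift1; by_cong cong_addN. Qed.

HB.instance Definition _ :=
  GRing.isZmodule.Build A pres_addA pres_addC pres_add0 pres_addN.

Fact pres_mulA : associative pres_mul.
Proof. by do 3!lift1; by_cong cong_mulA. Qed.
Fact pres_mul1l : left_id (pres_class (PScal 1)) pres_mul.
Proof. by lift1; by_cong cong_mul1l. Qed.
Fact pres_mul1r : right_id (pres_class (PScal 1)) pres_mul.
Proof. by lift1; by_cong cong_mul1r. Qed.
Fact pres_mulDl : left_distributive pres_mul pres_add.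
Proof. by do 3!lift1; by_cong cong_mulDl. Qed.
Fact pres_mulDr : right_distributive pres_mul pres_add.
Proof. by do 3!lift1; by_cong cong_mulDr. Qed.

HB.instance Definition _ := GRing.Zmodule_isPzRing.Build A
  pres_mulA pres_mul1l pres_mul1r pres_mulDl pres_mulDr.

Fact pres_scaleA a b x : pres_scale a (pres_scale b x) = pres_scale (a * b) x.
Proof.
move: x; lift1; rewrite !presE; apply/pres_classP.
apply: cong_trans (cong_mulA _ _ _) _.
by apply: cong_mul (cong_sym (cong_scalM _ _)) (cong_refl _).
Qed.
Fact pres_scale1 : left_id 1 pres_scale.
Proof. by lift1; by_cong cong_mul1l. Qed.
Fact pres_scaleDr : right_distributive pres_scale +%R.
Proof.
by move=> a; do 2!lift1; rewrite /GRing.add /=; by_cong cong_mulDr.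
Qed.
Fact pres_scaleDl x : {morph pres_scale^~ x : a b / a + b}.
Proof.
move=> a b; move: x; lift1; rewrite /= [RHS]/GRing.add /= !presE.
apply/pres_classP; apply: cong_trans (cong_mulDl _ _ _).
exact: cong_mul (cong_scalD _ _) (cong_refl _).
Qed.

HB.instance Definition _ := GRing.Zmodule_isLmodule.Build K A
  pres_scaleA pres_scale1 pres_scaleDr pres_scaleDl.

Fact pres_scaleAl (a : K) (x y : A) : a *: (x * y) = (a *: x) * y.
Proof. 
by move: x y; do 2!lift1; rewrite /GRing.mul /GRing.scale /=; by_cong cong_mulA.
Qed.

Fact pres_scaleAr (a : K) (x y : A) : a *: (x * y) = x * (a *: y).
Proof.
move: x y; do 2!lift1; rewrite /GRing.mul /GRing.scale /= !presE.
apply/pres_classP; apply: cong_trans (cong_mulA _ _ _) _.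
apply: cong_trans (cong_mul (cong_scalC _ _) (cong_refl _)) _.
exact: cong_sym (cong_mulA _ _ _).
Qed.

(* Together with the ring and module structures, the last two facts say that  *)
(* A is an associative unital K-algebra. It cannot be an instance of          *)
(* [algType], which requires 1 != 0.                                          *)

End PresentedAlgebra.

Section ChekhovFock.
Variables (F : fieldType) (n : nat) (q : F) (sigma : 'I_n -> 'I_n -> int).

(* The generator (i, b) stands for X_i if b = true and X_i^-1 if b = false. *)
Variant cf_rels : pres_expr F ('I_n * bool) -> pres_expr F ('I_n * bool) -> Prop :=
| cf_rel_inv i b :
    cf_rels (PMul (PGen (i, b)) (PGen (i, ~~ b))) (PScal 1)
| cf_rel_comm i j :
    cf_rels (PMul (PGen (i, true)) (PGen (j, true)))
            (PMul (PScal (q ^ (2 * sigma i j)))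
                  (PMul (PGen (j, true)) (PGen (i, true)))).

Definition cf_algebra : Type := presented_algebra cf_rels.

Definition cfX (i : 'I_n) : cf_algebra := pres_class cf_rels (PGen (i, true)).
Definition cfXV (i : 'I_n) : cf_algebra := pres_class cf_rels (PGen (i, false)).

Definition cfXz (i : 'I_n) (k : int) : cf_algebra :=
  match k with Posz m => cfX i ^+ m | Negz m => cfXV i ^+ m.+1 end.

(* the Weyl ordering [X_1^{k_1} ... X_n^{k_n}] *)
Definition weyl (k : 'I_n -> int) : cf_algebra :=
  q ^ (- \sum_(i < n) \sum_(j < n | (i < j)%N) k i * k j * sigma i j)
    *: \prod_(i < n) cfXz i (k i).

End ChekhovFock.

Definition triangle_sigma (i j : 'I_3) : int :=
  (j == ordS i)%:Z - (i == ordS j)%:Z.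

Definition triangle_algebra (F : fieldType) (q : F) : Type :=
  cf_algebra q triangle_sigma.

(* An ideal triangulation with m faces, n labelled edges and s labelled       *)
(* punctures of a closed connected oriented surface of genus g, as a gluing   *)
(* of m oriented triangles. The three sides (f, 0), (f, 1), (f, 2) of the     *)
(* face f are numbered clockwise along its boundary. Sides are glued in pairs *)
(* by the fixed-point free involution [opp], reversing their boundary         *)
(* orientations. The corner of f between (f, i) and (f, ordS i) is also       *)
(* denoted (f, i): it sits at the clockwise end of the side (f, i), and as    *)
(* seen from its vertex (f, i) comes before (f, ordS i) counterclockwise.     *)
(* Turning around the vertex, the corner (f, i) is followed by the one at the *)
(* clockwise start of the side glued to (f, i), so vertices of the            *)
(* triangulation are the orbits of [next_corner].                             *)
Definition side (m : nat) : finType := ('I_m * 'I_3)%type.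
Definition next_side (m : nat) (a : side m) : side m := (a.1, ordS a.2).
Definition prev_side (m : nat) (a : side m) : side m := (a.1, ord_pred a.2).
Definition next_corner (m : nat) (opp : side m -> side m) (a : side m) : side m :=
  prev_side (opp a).

Record ideal_triangulation (g s m n : nat) := IdealTriangulation {
  opp : side m -> side m;
  oppK : involutive opp;
  opp_neq : forall a, opp a != a;
  edge : side m -> 'I_n;
  edge_surj : forall e, exists a, edge a = e;
  edge_eq : forall a b, (edge a == edge b) = (b == a) || (b == opp a);
  punct : side m -> 'I_s;
  punct_surj : forall v, exists a, punct a = v;
  punct_eq : forall a b,
    (punct a == punct b) = fconnect (next_corner opp) a b;
  connected : forall a b,
    connect [rel c d | (d == next_side c) || (d == opp c)] a b;
  (* Euler characteristic *)
  euler : s%:Z - n%:Z + m%:Z = 2 - 2 * g%:Z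
}.

Section Triangulation.
Variables (g s m n : nat) (lam : ideal_triangulation g s m n).
Variables (F : fieldType) (q : F).

Definition sectors (i j : 'I_n) : nat :=
  #|[set a : side m | (edge lam a == i) && (edge lam (next_side a) == j)]|.

Definition fock (i j : 'I_n) : int := (sectors i j)%:Z - (sectors j i)%:Z.

Definition cf_lam : Type := cf_algebra q fock.

(* k_{ji}: a small loop around v_j meets lambda_i once for each end of        *)
(* lambda_i at v_j; the two ends of lambda_i are the clockwise ends of the    *)
(* two sides forming it.                                                      *)
Definition punct_mult (j : 'I_s) (i : 'I_n) : nat :=
  #|[set a : side m | (edge lam a == i) && (punct lam a == j)]|.

Definition cfH : cf_lam := weyl q fock (fun=> 1).
Definition cfP (j : 'I_s) : cf_lam := weyl q fock (fun i => (punct_mult j i)%:Z).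

(* The factor in the triangle algebra of the face f of the image of X_e under *)
(* the embedding of cf_lam into the tensor product of the triangle algebras:  *)
(* 1, X_k or the Weyl ordered [X_k X_l] according to whether no side, one     *)
(* side k or two sides k, l of f correspond to the edge e.                    *)
Definition iota_factor (e : 'I_n) (f : 'I_m) : triangle_algebra q :=
  weyl q triangle_sigma (fun k => (edge lam (f, k) == e)%:Z).

End Triangulation.

(* Note that multiplication in the algebra goes to composition of functions;  *)
(* the library's ring structure on 'End(V) has the opposite multiplication.   *)
Record representation (F : fieldType) (I : Type)
    (rels : pres_expr F I -> pres_expr F I -> Prop) (V : vectType F) :=
  Representation {
    rep_fun :> presented_algebra rels -> 'End(V);
    rep_linear : linear rep_fun;
    rep1 : rep_fun 1 = \1%VF;
    repM : forall a b, rep_fun (a * b) = (rep_fun a \o rep_fun b)%VF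
  }.

Section Representations.
Variables (F : fieldType) (I : Type).
Variable rels : pres_expr F I -> pres_expr F I -> Prop.
Local Notation A := (presented_algebra rels).
Local Notation representation := (representation rels).

Definition irreducible_rep (V : vectType F) (rho : representation V) : Prop :=
  (fullv : {vspace V}) <> 0%VS /\
  forall U : {vspace V},
    (forall a, (rho a @: U <= U)%VS) -> U = 0%VS \/ U = fullv.

Definition acts_by (V : vectType F) (rho : representation V)
    (a : A) (z : F) : Prop :=
  rho a = (z *: \1)%VF.

Definition is_restriction (V : vectType F) (rho : representation V)
    (W : {vspace V}) (rhoW : representation (subvs_of W)) : Prop :=
  forall a w, vsval (rhoW a w) = rho a (vsval w).

End Representations.

Definition triangle_rep (F : fieldType) (q : F) (V : vectType F) : Type :=
  representation (cf_rels q triangle_sigma) V.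

Definition cf_rep (g s m n : nat) (lam : ideal_triangulation g s m n)
    (F : fieldType) (q : F) (V : vectType F) : Type :=
  representation (cf_rels q (fock lam)) V.

Section TensorProduct.
Variables (F : fieldType) (m : nat) (V_ : 'I_m -> vectType F).

Definition multilinear_map (W : vectType F) (phi : (forall f, V_ f) -> W) : Prop :=
  forall (v : forall f, V_ f) (f : 'I_m) (a : F) (x y : V_ f),
    phi (dfwith v (a *: x + y)) = a *: phi (dfwith v x) + phi (dfwith v y).

(* (V, tau) is the tensor product of the V_ f, tau v being the elementary     *)
(* tensor of the v f.                                                         *)
Definition is_tensor_product (V : vectType F) (tau : (forall f, V_ f) -> V) : Prop :=
  multilinear_map tau /\
  forall (W : vectType F) (phi : (forall f, V_ f) -> W), multilinear_map phi ->
    exists! h : 'Hom(V, W), forall v, h (tau v) = phi v.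

End TensorProduct.

Section LocalRepresentations.
Variables (g s m n : nat) (lam : ideal_triangulation g s m n).
Variables (F : fieldType) (q : F).

(* rho is (rho_1 (x) ... (x) rho_m) \o iota; such an equality of              *)
(* representations is tested on the generators X_e.                           *)
Definition local_rep (V : vectType F) (rho : cf_rep lam q V) : Prop :=
  exists (V_ : 'I_m -> vectType F)
         (rho_ : forall f, triangle_rep q (V_ f))
         (tau : (forall f, V_ f) -> V),
    [/\ forall f, irreducible_rep (rho_ f),
        is_tensor_product tau &
        forall e v, rho (cfX q (fock lam) e) (tau v)
                    = tau (fun f => rho_ f (iota_factor lam q e f) (v f))].

(* Central data common to the local and the irreducible representations       *)
(* classified by edge weights x and central load c.                           *)
Definition edge_weights (N : nat) (V : vectType F)
    (rho : cf_rep lam q V) (x : 'I_n -> F) : Prop :=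
  forall e, acts_by rho (cfX q (fock lam) e ^+ N) (x e).

Definition classified_local (N : nat) (V : vectType F)
    (rho : cf_rep lam q V) (x : 'I_n -> F) (c : F) : Prop :=
  [/\ local_rep rho, edge_weights N rho x & acts_by rho (cfH lam q) c].

Definition classified_irreducible (N : nat) (V : vectType F)
    (rho : cf_rep lam q V)
    (x : 'I_n -> F) (p : 'I_s -> F) (c : F) : Prop :=
  [/\ irreducible_rep rho, edge_weights N rho x,
      forall v, acts_by rho (cfP lam q v) (p v) & acts_by rho (cfH lam q) c].

Definition puncture_root (N : nat) (x : 'I_n -> F) (p : 'I_s -> F) : Prop :=
  forall v, p v ^+ N = \prod_(e < n) x e ^+ punct_mult lam v e.

End LocalRepresentations.

(* Main.v *)
Require Import Defs.
From HB Require Import structures.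
From mathcomp Require Import all_boot all_order all_algebra.
From mathcomp Require Import boolp reals complex.
From mathcomp Require Import ring zify.

Set Implicit Arguments.
Unset Strict Implicit.
Unset Printing Implicit Defensive.

Import Order.TTheory GRing.Theory Num.Theory.
Local Open Scope ring_scope.

(** Everything happens modulo N. The operators of a representation whose
    generators have scalar N-th powers form a projective representation of the
    finite group of exponent vectors modulo N, and [weylnM] says that its
    commutation rule is the skew form defined by the Fock matrix. Averaging
    over this group gives complete reducibility ([maschke], [semisimple]) and
    the orthogonality of traces ([trace_orthogonality]), whose consequence
    [irreducible_dim] is that an irreducible representation of dimension d
    satisfies d^2 * r = N^n, where r is the number of exponent vectors in the
    radical of the skew form modulo N.

    For a triangle the radical consists of the constant vectors, so the
    irreducible representations have dimension N and a local representation V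
    has dimension N^m ([local_dim]). For the Fock matrix, turning around the
    vertices shows, N being odd, that the radical is freely generated by the
    exponent vectors of the puncture invariants ([fock_radical],
    [card_fock_radical]). With the Euler characteristic this gives the
    dimension N^(3g-3+s) of the irreducible summands of V
    ([irreducible_dim_surface]), and by Schur's lemma every puncture invariant
    acts on each summand by a scalar.

    It remains to compute the dimension of the part of V on which each P_v acts
    by the prescribed p_v. This part is the image of the projector
      N^(-s) * sum over w in (Z/N)^s of the prod_v (P_v / p_v)^(w_v),
    so its dimension is the trace of the projector. The generator of a triangle
    algebra attached to one side of a face acts on V and commutes with all X_e
    up to powers of q ([local_side_op]). For this reason the trace of
    prod_v P_v^(w_v) vanishes unless this product commutes with all these
    operators, and connectedness of the surface forces w to be constant
    ([multiloop_constant]). The constant w = t contributes H^(2t) = c^(2t),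
    which the product of the p_v compensates, so the trace is
    N^(-s) * N * N^m. Dividing by N^(3g-3+s) and using m = 4g-4+2s leaves
    N^g summands. *)

(** * Traces of endomorphisms *)

(** Through a full rank factorization A = C R: idempotence forces R C = 1, and
    the traces of C R and R C agree. *)
Lemma mxtrace_idempotent (F : fieldType) d (A : 'M[F]_d) :
  A *m A = A -> \tr A = (\rank A)%:R.
Proof.
move=> AA.
have full_rank r (C : 'M_(d, r)) (R : 'M_(r, d)) :
    row_full C -> row_free R -> C *m R = A -> \tr A = r%:R.
  move=> /mulVpmx LC /mulmxVp RS CRA.
  move: (pinvmx C) (pinvmx R) LC RS => L S LC RS.
  suff RC1 : R *m C = 1%:M by rewrite -CRA mxtrace_mulC RC1 mxtrace1.
  have CRCR : C *m R *m (C *m R) = C *m R by rewrite CRA.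
  have := congr1 (fun B => L *m B *m S) CRCR.
  by rewrite /= !mulmxA LC mul1mx -!mulmxA RS mulmx1.
exact: full_rank (col_base_full A) (row_base_free A) (mulmx_base A).
Qed.

Section Trace.
Import VectorInternalTheory.
Variables (F : fieldType) (V : vectType F).
Implicit Types f g : 'End(V).

Lemma mul_f2mx f (u : 'rV_(dim V)) : u *m f2mx f = v2r (f (r2v u)).
Proof. by rewrite unlock /fun_of_lfun_def /= !r2vK. Qed.

Lemma f2mx_comp f g : f2mx (f \o g)%VF = f2mx g *m f2mx f.
Proof.
by apply/row_matrixP=> i; rewrite !rowE mulmxA !mul_f2mx comp_lfunE v2rK.
Qed.

Lemma f2mx_is_linear : linear (f2mx : 'End(V) -> 'M_(dim V)).
Proof.
move=> a f g; apply/row_matrixP=> i; rewrite !rowE mulmxDr -scalemxAr.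
by rewrite !mul_f2mx add_lfunE scale_lfunE linearP.
Qed.
HB.instance Definition _ := GRing.isLinear.Build F 'End(V) 'M_(dim V) _
  (f2mx : 'End(V) -> 'M_(dim V)) f2mx_is_linear.

Lemma f2mx1 : f2mx (\1%VF : 'End(V)) = 1%:M.
Proof.
by apply/row_matrixP=> i; rewrite !rowE mul_f2mx id_lfunE r2vK mulmx1.
Qed.

Definition lftrace f : F := \tr (f2mx f).

Lemma lftrace_is_linear : linear_for *%R lftrace.
Proof. by move=> a f g; rewrite /lftrace !linearP. Qed.
HB.instance Definition _ :=
  GRing.isLinear.Build F 'End(V) F _ lftrace lftrace_is_linear.

Lemma lftraceC f g : lftrace (f \o g)%VF = lftrace (g \o f)%VF.
Proof. by rewrite /lftrace !f2mx_comp mxtrace_mulC. Qed.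

Lemma lftrace1 : lftrace \1%VF = (\dim {:V})%:R.
Proof. by rewrite /lftrace f2mx1 mxtrace1 dimvf. Qed.

Lemma lftrace_idempotent f :
  (f \o f)%VF = f -> lftrace f = (\dim (limg f))%:R.
Proof.
move=> ff; rewrite /lftrace mxtrace_idempotent -?f2mx_comp ?ff //.
have -> : limg f = mx2vs (vs2mx fullv *m f2mx f) by rewrite unlock.
by rewrite /dimv /= !genmxE genmx1 mul1mx.
Qed.

(** Conjugation by f multiplies g by z without changing its trace. *)
Lemma lftrace_qcomm f g z :
  lker f == 0%VS -> (f \o g)%VF = z *: (g \o f)%VF -> z != 1 ->
  lftrace g = 0.
Proof.
move=> f0 fg z1; have : lftrace g = z * lftrace g.
  rewrite -{1}(lker0_compKf f0 g) lftraceC fg -comp_lfunZl -linearZ /=.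
  by rewrite lker0_compfK.
move/eqP; rewrite -subr_eq0 -{1}[lftrace g]mul1r -mulrBl mulf_eq0 subr_eq0.
by rewrite eq_sym (negPf z1) => /eqP.
Qed.
End Trace.

(** * Projective representations of finite abelian groups *)

(** Exponent vectors modulo N are finite functions with values in 'I_N, whose
    additive structure, unlike its ring structure, also exists for N = 1. *)
HB.instance Definition _ (I : finType) (A : finZmodType) :=
  Finite.on {ffun I -> A}.

Section LinearOperators.
Variables (F : fieldType) (V : vectType F).
Implicit Types f g : 'End(V).

Lemma lker0_left_inverse f g : (g \o f)%VF = \1%VF -> lker f == 0%VS.
Proof.
move=> gf; apply/lker0P=> u v /(congr1 g).
by rewrite -!comp_lfunE gf !id_lfunE.
Qed.

Lemma inv_lfun_unique f g : (g \o f)%VF = \1%VF -> (f^-1)%VF = g.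
Proof.
move=> gf; rewrite -[RHS](lker0_compfK (lker0_left_inverse gf)) gf.
by rewrite comp_lfun1l.
Qed.

Lemma stable_lfunP f (W : {vspace V}) :
  reflect (forall w, w \in W -> f w \in W) (f @: W <= W)%VS.
Proof.
apply: (iffP subvP) => fW w.
  by move=> Ww; apply/fW/memv_img.
by case/memv_imgP=> v Wv ->; apply: fW.
Qed.

End LinearOperators.

Lemma mulmx_delta_entry (F : fieldType) d (B C : 'M[F]_d) i j a b :
  (B *m (delta_mx i j *m C)) a b = B a i * C j b.
Proof.
rewrite mxE (bigD1 i) //= mxE (bigD1 j) //= !mxE !eqxx mul1r.
rewrite !big1 ?addr0 // => k /negPf ki; last by rewrite mxE ki andbF mul0r.
rewrite [X in _ * X]mxE big1 ?mulr0 // => l _.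
by rewrite mxE ki mul0r.
Qed.

Section ProjectiveRepresentation.
Import VectorInternalTheory.
Variables (F : numClosedFieldType) (V : vectType F) (A : finZmodType).
Variable U : A -> 'End(V).
Hypothesis U0 : U 0 = \1%VF.
Hypothesis UD : forall k l,
  exists2 z, z != 0 & (U k \o U l)%VF = z *: U (k + l).

Lemma proj_invE k : exists2 z, z != 0 & ((U k)^-1)%VF = z *: U (- k).
Proof.
have [z z0 Uz] := UD (- k) k; exists z^-1; first by rewrite invr_eq0.
apply: inv_lfun_unique; rewrite -comp_lfunZl Uz addNr U0 scalerA.
by rewrite mulVf // scale1r.
Qed.

Lemma proj_lker0 k : lker (U k) == 0%VS.
Proof.
have [z z0 Uz] := UD (- k) k.
apply: (@lker0_left_inverse _ _ _ (z^-1 *: U (- k))).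
by rewrite -comp_lfunZl Uz addNr U0 scalerA mulVf // scale1r.
Qed.

Lemma proj_qcomm k l :
  exists z, (U l \o U k)%VF = z *: (U k \o U l)%VF.
Proof.
have [z z0 Uz] := UD l k; have [y y0 Uy] := UD k l.
by exists (z / y); rewrite Uy addrC Uz scalerA divfK.
Qed.

(** The nonzero factors by which U fails to be multiplicative cancel under
    conjugation, so conjugation is an honest action of A. *)
Lemma proj_conjD k l f :
  (U l \o (U k \o f \o (U k)^-1) \o (U l)^-1)%VF
    = (U (l + k) \o f \o (U (l + k))^-1)%VF.
Proof.
have [z z0 Uz] := UD l k.
have -> : ((U (l + k))^-1)%VF = z *: ((U k)^-1 \o (U l)^-1)%VF.
  apply: inv_lfun_unique; rewrite -comp_lfunZl comp_lfunZr -Uz.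
  by rewrite -comp_lfunA lker0_compKf ?proj_lker0 // lker0_compVf ?proj_lker0.
by rewrite -comp_lfunZr !comp_lfunZl -Uz !comp_lfunA.
Qed.

Definition proj_avg f : 'End(V) := \sum_k (U k \o f \o (U k)^-1)%VF.

Lemma proj_avgC f l : (U l \o proj_avg f)%VF = (proj_avg f \o U l)%VF.
Proof.
suff fU : (U l \o proj_avg f \o (U l)^-1)%VF = proj_avg f.
  by rewrite -[in RHS]fU lker0_compfVK ?proj_lker0.
rewrite {2}/proj_avg (reindex (+%R l)) /=; last first.
  by exists (fun k => - l + k) => k _; rewrite ?addKr ?addNKr.
under [RHS]eq_bigr do rewrite -proj_conjD.
apply/lfunP=> u; rewrite !comp_lfunE !sum_lfunE linear_sum.
by apply: eq_bigr => k _; rewrite !comp_lfunE.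
Qed.

(** The average of a projection onto W is still a projection onto W, and it
    commutes with the action; its kernel is the complement. *)
Lemma maschke (W : {vspace V}) : (forall k, (U k @: W <= W)%VS) ->
  exists C : {vspace V}, [/\ forall k, (U k @: C <= C)%VS,
    (W + C)%VS = fullv & (W :&: C)%VS = 0%VS].
Proof.
move=> WU.
have WV k w : w \in W -> ((U k)^-1)%VF w \in W.
  move=> Ww; have [z _ ->] := proj_invE k; rewrite scale_lfunE memvZ //.
  exact: (stable_lfunP _ _ (WU (- k))).
have WU' k w : w \in W -> U k w \in W by apply/stable_lfunP.
pose f := #|A|%:R^-1 *: proj_avg (projv W).
have cardA : (#|A|%:R : F) != 0.
  by rewrite pnatr_eq0 -lt0n; apply/card_gt0P; exists 0.
have fW w : w \in W -> f w = w.
  move=> Ww; rewrite scale_lfunE sum_lfunE (eq_bigr (fun=> w)).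
    by rewrite sumr_const -scaler_nat scalerA mulVf // scale1r.
  move=> k _; rewrite !comp_lfunE projv_id ?WV //.
  by rewrite lker0_lfunVK ?proj_lker0.
have fV v : f v \in W.
  rewrite scale_lfunE memvZ // sum_lfunE memv_suml // => k _.
  by rewrite !comp_lfunE WU' // memv_proj.
exists (lker f); split=> [k||].
- apply/stable_lfunP=> v; rewrite !memv_ker => /eqP fv0.
  rewrite scale_lfunE -comp_lfunE -proj_avgC comp_lfunE -linearZ /=.
  by rewrite -scale_lfunE -/f fv0 linear0.
- apply/eqP; rewrite eqEsubv subvf; apply/subvP=> v _.
  rewrite -(subrK (f v) v) addrC memv_add //.
  by rewrite memv_ker linearB /= (fW (f v)) // subrr.
- apply/eqP; rewrite -subv0; apply/subvP=> v; rewrite memv_cap memv_ker.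
  by case/andP=> Wv; rewrite fW // memv0.
Qed.

Hypothesis schur : forall g : 'End(V),
  (forall k, (U k \o g)%VF = (g \o U k)%VF) -> exists z, g = z *: \1%VF.
Hypothesis dimV_gt0 : (0 < \dim {:V})%N.

(** By Schur, the average of a matrix M is the scalar matrix of value
    #|A| tr(M) / d. Taking for M the elementary matrices E_ij and summing the
    (i, j) entries of their averages yields both sides. *)
Lemma trace_orthogonality :
  \sum_k lftrace (U k) * lftrace ((U k)^-1)%VF = #|A|%:R.
Proof.
pose d := dim V; have d0 : (d%:R : F) != 0.
  by rewrite pnatr_eq0 -lt0n /d -dimvf.
have avgE (M : 'M[F]_d) :
    f2mx (proj_avg (@Hom _ V V M)) = (#|A|%:R * \tr M / d%:R)%:M.
  have [z zE] := schur (proj_avgC (@Hom _ V V M)); rewrite zE.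
  have := congr1 (@lftrace _ _) zE.
  rewrite linearZ /= lftrace1 dimvf -/d linear_sum (eq_bigr (fun=> \tr M)).
    rewrite sumr_const => zd; rewrite mulr_natl {}zd mulfK //.
    by rewrite linearZ /= f2mx1 scalemx1.
  move=> k _ /=; rewrite lftraceC lker0_compKf ?proj_lker0 //.
transitivity (\sum_i \sum_j f2mx (proj_avg (@Hom _ V V (delta_mx i j))) i j).
  rewrite (eq_bigr (fun i => \sum_j \sum_k
      f2mx (U k) j j * f2mx ((U k)^-1)%VF i i)).
    under eq_bigr => i _ do rewrite exchange_big /=.
    rewrite exchange_big; apply: eq_bigr => k _; rewrite exchange_big /=.
    rewrite mulr_suml; apply: eq_bigr => j _.
    by rewrite mulr_sumr.
  move=> i _; apply: eq_bigr => j _; rewrite linear_sum summxE.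
  apply: eq_bigr => k _; rewrite [GRing.Linear.sort _ _]/= !f2mx_comp.
  by rewrite mulmx_delta_entry mulrC.
under eq_bigr => i _ do under eq_bigr => j _ do rewrite avgE mxE.
rewrite (eq_bigr (fun=> #|A|%:R / d%:R)) => [|i _].
  by rewrite sumr_const card_ord -[LHS]mulr_natr divfK.
rewrite (bigD1 i) //= eqxx mulr1n big1 ?addr0 => [|j /negPf ji].
  rewrite /mxtrace (bigD1 i) //= mxE eqxx big1 ?addr0 ?mulr1 // => j /negPf ji.
  by rewrite mxE ji.
by rewrite eq_sym ji mulr0n.
Qed.

(** In [trace_orthogonality], an operator that does not commute with the
    others has trace zero, and one that does is scalar and contributes the
    square of the dimension. *)
Lemma irreducible_dim (R : pred A) :
    (forall k, R k <-> forall l, (U l \o U k)%VF = (U k \o U l)%VF) ->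
  (\dim {:V} ^ 2 * #|R| = #|A|)%N.
Proof.
move=> RP; apply/eqP; rewrite -(eqr_nat F) -trace_orthogonality.
rewrite (bigID R) /= [X in _ + X]big1 ?addr0 => [|k nRk]; last first.
  have [l] : exists l, (U l \o U k)%VF != (U k \o U l)%VF.
    apply: contrapT => H; move/negP: nRk; apply; apply/RP => l.
    by apply/eqP; apply: contrapT => /negP nE; apply: H; exists l.
  have [z zE] := proj_qcomm k l; have [z1|z1 _] := eqVneq z 1.
    by rewrite zE z1 scale1r eqxx.
  by rewrite (lftrace_qcomm (proj_lker0 l) zE) ?mul0r.
rewrite (eq_bigr (fun=> (\dim {:V} ^ 2)%:R)) => [|k].
  by rewrite sumr_const natrM mulr_natr.
move=> /RP kC; have [z zE] := schur kC.
have z0 : z != 0.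
  apply/eqP => z0; move: dimV_gt0; rewrite lt0n -(eqr_nat F) -lftrace1.
  rewrite -(lker0_compVf (proj_lker0 k)) zE z0 scale0r comp_lfun0r.
  by rewrite linear0 eqxx.
rewrite (@inv_lfun_unique _ _ (U k) (z^-1 *: \1%VF)) zE.
  by rewrite !linearZ /= lftrace1 mulrACA divff // mul1r natrX expr2.
by rewrite -comp_lfunZl -comp_lfunZr comp_lfun1l scalerA mulVf // scale1r.
Qed.

End ProjectiveRepresentation.

(** * Weyl-ordered monomials *)

Section QuantumMonomials.
Variables (F : fieldType) (I : Type).
Variable rels : pres_expr F I -> pres_expr F I -> Prop.
Local Notation A := (presented_algebra rels).
Implicit Types (x y : A).

Lemma pres_mulZ a b x y : (a *: x) * (b *: y) = (a * b) *: (x * y).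
Proof. by rewrite -pres_scaleAl -pres_scaleAr scalerA. Qed.

Lemma qcomm_prod J (r : seq J) (Y : J -> A) (z : J -> F) x :
  (forall j, Y j * x = z j *: (x * Y j)) ->
  \prod_(j <- r) Y j * x = (\prod_(j <- r) z j) *: (x * \prod_(j <- r) Y j).
Proof.
move=> Yx; elim: r => [|j r IHr]; first by rewrite !big_nil mul1r mulr1 scale1r.
rewrite !big_cons -mulrA IHr -pres_scaleAr mulrA Yx -pres_scaleAl scalerA.
by rewrite mulrA mulrC.
Qed.

Lemma qcommX z x y a b :
  x * y = z *: (y * x) ->
  x ^+ a * y ^+ b = z ^+ (a * b) *: (y ^+ b * x ^+ a).
Proof.
move=> xy; have xyb : x * y ^+ b = z ^+ b *: (y ^+ b * x).
  elim: b => [|b IHb]; first by rewrite !expr0 mulr1 mul1r scale1r.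
  rewrite !exprS mulrA xy -pres_scaleAl -mulrA IHb -pres_scaleAr scalerA.
  by rewrite mulrA.
elim: a => [|a IHa]; first by rewrite !expr0 mulr1 mul1r scale1r.
rewrite [x ^+ a.+1]exprS -mulrA IHa -pres_scaleAr mulrA xyb -pres_scaleAl.
by rewrite scalerA -exprD mulSn addnC mulrA.
Qed.

(** Collecting the factors X_i means moving X_j to the left of X_i for all
    j < i. *)
Lemma qmonomialM n (X : 'I_n -> A) (z : 'I_n -> 'I_n -> F) (k l : 'I_n -> nat) :
  (forall i j, X i * X j = z i j *: (X j * X i)) ->
  \prod_i X i ^+ k i * \prod_i X i ^+ l i
  = (\prod_(i < n) \prod_(j < n | (j < i)%N) z i j ^+ (k i * l j))
    *: \prod_i X i ^+ (k i + l i).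
Proof.
elim: n X z k l => [|n IHn] X z k l Xz.
  by rewrite !big_ord0 mulr1 scale1r.
rewrite !big_ord_recl /= mulrA -[in LHS](mulrA (X ord0 ^+ k ord0)).
rewrite (@qcomm_prod _ _ _
  (fun i => z (lift ord0 i) ord0 ^+ (k (lift ord0 i) * l ord0)));
  last by move=> i; apply: qcommX.
rewrite -pres_scaleAr -pres_scaleAl mulrA -exprD -mulrA.
rewrite (IHn (fun i => X (lift ord0 i))
  (fun i j => z (lift ord0 i) (lift ord0 j))) //.
rewrite -pres_scaleAr scalerA; congr (_ *: _).
rewrite [in RHS]big1 ?mul1r // -big_split /=; apply: eq_bigr => i _.
by rewrite [RHS]big_mkcond big_ord_recl /= -big_mkcond.
Qed.

End QuantumMonomials.

Lemma expfz_sum (F : fieldType) (q : F) J (r : seq J) (P : pred J)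
    (f : J -> int) :
  q != 0 -> q ^ (\sum_(j <- r | P j) f j) = \prod_(j <- r | P j) q ^ f j.
Proof. by move=> q0; apply: big_morph => [a b|]; rewrite ?expfzDr. Qed.

Section WeylOrdering.
Variables (F : fieldType) (n : nat) (q : F) (sigma : 'I_n -> 'I_n -> int).
Hypothesis q0 : q != 0.
Hypothesis sigmaN : forall i j, sigma j i = - sigma i j.

Local Notation A := (cf_algebra q sigma).
Local Notation rels := (cf_rels q sigma).

(** Weyl-ordered monomials with nonnegative exponents; these suffice because the
    N-th powers of the generators act by nonzero scalars. *)
Definition weyln (k : 'I_n -> nat) : A := weyl q sigma (fun i => (k i)%:Z).

(** The skew-symmetric form of the matrix sigma, on exponent vectors. *)
Definition sform (k l : 'I_n -> nat) : int :=
  \sum_(i < n) \sum_(j < n) (k i)%:Z * (l j)%:Z * sigma i j.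

Let sumlt (f : 'I_n -> 'I_n -> int) :=
  \sum_(i < n) \sum_(j < n | (i < j)%N) f i j.

Lemma sum_gt (f : 'I_n -> 'I_n -> int) :
  \sum_(i < n) \sum_(j < n | (j < i)%N) f i j = sumlt (fun i j => f j i).
Proof. by rewrite (exchange_big_dep predT). Qed.

Lemma sum_ltgt (f : 'I_n -> 'I_n -> int) : (forall i, f i i = 0) ->
  \sum_(i < n) \sum_(j < n) f i j = sumlt (fun i j => f i j + f j i).
Proof.
move=> f0; rewrite /sumlt [RHS](eq_bigr _ (fun i _ => big_split _ _ _ _ _)).
rewrite big_split /= -[X in _ = _ + X]sum_gt -big_split; apply: eq_bigr => i _.
rewrite (bigID (fun j : 'I_n => (i < j)%N)) /=; congr (_ + _).
rewrite (bigD1 i) ?ltnn //= f0 add0r; apply: eq_bigl => j.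
by rewrite -leqNgt ltn_neqAle andbC.
Qed.

Lemma sigma_diag i : sigma i i = 0.
Proof.
have : sigma i i *+ 2 == 0 by rewrite mulr2n {1}sigmaN addNr.
by rewrite mulrn_eq0 => /eqP.
Qed.

Lemma sformN (k l : 'I_n -> nat) : sform l k = - sform k l.
Proof.
rewrite /sform exchange_big /= -sumrN; apply: eq_bigr => i _.
rewrite -sumrN; apply: eq_bigr => j _.
by rewrite sigmaN mulrN [_ * (k i)%:Z]mulrC.
Qed.

Lemma cfX_comm i j :
  cfX q sigma i * cfX q sigma j
    = q ^ (2 * sigma i j) *: (cfX q sigma j * cfX q sigma i).
Proof.
rewrite /cfX /GRing.mul /GRing.scale /= !pres_mulE pres_scaleE.
by apply/pres_classP/cong_rel/cf_rel_comm.
Qed.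

Lemma weylnE k :
  weyln k = q ^ (- sumlt (fun i j => (k i)%:Z * (k j)%:Z * sigma i j))
    *: \prod_i cfX q sigma i ^+ k i.
Proof. by []. Qed.

(** The Weyl factors are chosen to make the cocycle of the product
    antisymmetric. *)
Lemma weylnM k l :
  weyln k * weyln l = q ^ (sform k l) *: weyln (fun i => k i + l i)%N.
Proof.
rewrite !weylnE pres_mulZ (qmonomialM _ _ cfX_comm) !scalerA; congr (_ *: _).
have -> : \prod_(i < n) \prod_(j < n | (j < i)%N)
      (q ^ (2 * sigma i j)) ^+ (k i * l j)
    = q ^ (\sum_(i < n) \sum_(j < n | (j < i)%N)
        2 * sigma i j * (k i * l j)%:Z).
  rewrite expfz_sum //; apply: eq_bigr => i _; rewrite expfz_sum //.
  by apply: eq_bigr => j _; rewrite exprnP exprz_exp.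
rewrite -!expfzDr //; congr (q ^ _).
rewrite sum_gt /sform sum_ltgt => [|i]; last by rewrite sigma_diag mulr0.
rewrite -!sumrN -!big_split /=; apply: eq_bigr => i _.
rewrite -!sumrN -!big_split /=; apply: eq_bigr => j _.
by rewrite (sigmaN i j) !PoszD PoszM; ring.
Qed.

Lemma weyln_comm k l :
  weyln k * weyln l = q ^ (2 * sform k l) *: (weyln l * weyln k).
Proof.
rewrite !weylnM scalerA -expfzDr // (sformN k l).
have -> : 2 * sform k l - sform k l = sform k l by ring.
by under [in RHS]eq_fun do rewrite addnC.
Qed.

Lemma eq_weyln k l : k =1 l -> weyln k = weyln l.
Proof. by move=> /funext ->. Qed.

Lemma weyln0 : weyln (fun=> 0%N) = 1.
Proof.
rewrite weylnE /sumlt !big1 ?oppr0 ?expr0z ?scale1r // => i _.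
by rewrite big1 // => j _; rewrite mul0r.
Qed.

Lemma weyln_gen e : weyln (fun i => (i == e) : nat) = cfX q sigma e.
Proof.
rewrite weylnE /sumlt big1 ?oppr0 ?expr0z ?scale1r => [|i _]; last first.
  rewrite big1 // => j ij; case: eqP => [ie|_]; last by rewrite !mul0r.
  by case: eqP => [je|_]; [rewrite ie je ltnn in ij | rewrite mulr0 mul0r].
rewrite (eq_bigr (fun i => if i == e then cfX q sigma i else 1)) => [|i _].
  by rewrite -big_mkcond big_pred1_eq.
by case: eqP => _; rewrite ?expr1 ?expr0.
Qed.

Lemma weyln_scale N k : q ^+ N = 1 ->
  weyln (fun i => N * k i)%N = \prod_i (cfX q sigma i ^+ N) ^+ k i.
Proof.
move=> qN; rewrite weylnE -[RHS]scale1r; congr (_ *: _); last first.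
  by apply: eq_bigr => i _; rewrite exprM.
have -> : sumlt (fun i j => (N * k i)%:Z * (N * k j)%:Z * sigma i j)
    = N%:Z * (N%:Z * sumlt (fun i j => (k i)%:Z * (k j)%:Z * sigma i j)).
  rewrite /sumlt !mulr_sumr; apply: eq_bigr => i _.
  by rewrite !mulr_sumr; apply: eq_bigr => j _; rewrite !PoszM; ring.
by rewrite -mulrN -exprz_exp -exprnP qN exp1rz.
Qed.

End WeylOrdering.

(** * Representations of presented algebras *)

Section Representations.
Variables (F : fieldType) (I : Type).
Variable rels : pres_expr F I -> pres_expr F I -> Prop.
Variables (V : vectType F) (rho : representation rels V).
Local Notation A := (presented_algebra rels).
Implicit Types (a b : A) (z : F).

Lemma repZ z a : rho (z *: a) = z *: rho a.
Proof.
have := rep_linear rho z a 0; have := rep_linear rho 1 (0 : A) 0.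
rewrite !scale1r !addr0 => /eqP; rewrite eq_sym addrC -subr_eq0 addrK.
by move=> /eqP -> ->; rewrite addr0.
Qed.

Lemma repD a b : rho (a + b) = rho a + rho b.
Proof. by have := rep_linear rho 1 a b; rewrite !scale1r. Qed.

Lemma repX_scalar a z k : acts_by rho a z -> acts_by rho (a ^+ k) (z ^+ k).
Proof.
move=> az; rewrite /acts_by; elim: k => [|k IHk].
  by rewrite !expr0 rep1 scale1r.
by rewrite !exprS repM az IHk -comp_lfunZl comp_lfun1l scalerA.
Qed.

Lemma rep_prod_scalar J (r : seq J) (a : J -> A) (z : J -> F) :
  (forall j, acts_by rho (a j) (z j)) ->
  acts_by rho (\prod_(j <- r) a j) (\prod_(j <- r) z j).
Proof.
move=> az; rewrite /acts_by; elim: r => [|j r IHr].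
  by rewrite !big_nil rep1 scale1r.
by rewrite !big_cons repM az IHr -comp_lfunZl comp_lfun1l scalerA.
Qed.

(** Induction principle: a property of operators that holds on the generators
    and is stable under the algebra operations holds on the whole image. *)
Lemma rep_ind (Q : 'End(V) -> Prop) :
    Q \1%VF -> (forall z f g, Q f -> Q g -> Q (z *: f + g)) ->
    (forall f g, Q f -> Q g -> Q (f \o g)%VF) ->
    (forall i, Q (rho (pres_class rels (PGen i)))) ->
  forall a, Q (rho a).
Proof.
move=> Q1 QZD QM Qgen a; rewrite -(pres_classK a); move: (repr a) => {a}.
elim=> [i|z|t Qt u Qu|t Qt u Qu] //.
- have -> : pres_class rels (PScal z) = z *: (1 : A).
    rewrite /GRing.scale /GRing.one /= pres_scaleE.
    by apply/pres_classP/cong_sym/cong_mul1r.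
  rewrite repZ rep1; have -> : z *: \1%VF = (z - 1) *: \1%VF + \1%VF :> 'End(V).
    by rewrite scalerBl scale1r subrK.
  exact: QZD.
- by rewrite -pres_addE repD -[rho _]scale1r; apply: QZD.
- by rewrite -pres_mulE repM; apply: QM.
Qed.

End Representations.

Section SchurLemma.
Import VectorInternalTheory.

Lemma schur_rep (F : numClosedFieldType) I rels (V : vectType F)
    (rho : @representation F I rels V) (g : 'End(V)) :
  irreducible_rep rho -> (forall a, (rho a \o g)%VF = (g \o rho a)%VF) ->
  exists z, g = z *: \1%VF.
Proof.
move=> [V0 irr] gC.
have dV : (0 < dim V)%N by rewrite -dimvf lt0n dimv_eq0; apply/eqP.
have [z /eigenvalueP[v vz v0]] := spectral.eigenvalue_closed (f2mx g) dV.
exists z; have gv : g (r2v v) = z *: r2v v.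
  by rewrite -[LHS]v2rK -mul_f2mx vz linearZ.
have [a||gz] := irr (lker (g - z *: \1%VF)).
- apply/stable_lfunP => w /[!memv_ker] /[!add_lfunE] /[!opp_lfunE].
  rewrite !scale_lfunE !id_lfunE !subr_eq0 => /eqP gw.
  by rewrite -comp_lfunE -gC comp_lfunE gw linearZ.
- move=> k0; have : r2v v \in lker (g - z *: \1%VF).
    by rewrite memv_ker add_lfunE opp_lfunE scale_lfunE id_lfunE gv subrr.
  rewrite k0 memv0 => /eqP rv0; case/negP: v0; rewrite -(r2vK v) rv0.
  by rewrite linear0.
apply/lfunP => w; have : w \in lker (g - z *: \1%VF) by rewrite gz memvf.
by rewrite memv_ker add_lfunE opp_lfunE !scale_lfunE !id_lfunE subr_eq0 => /eqP.
Qed.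

End SchurLemma.

(** * Quantum tori at a root of unity *)

Section Zmod.
Variable N' : nat.
Local Notation N := N'.+1.

Lemma Zp_mulrz_eq0 (z : int) : (inZp 1 *~ z == 0 :> 'I_N) = (N%:Z %| z)%Z.
Proof.
have nat_case j : (inZp 1 *+ j == 0 :> 'I_N) = (N %| j)%N.
  by rewrite Zp_mulrn -val_eqE /= modnMml mul1n.
by case: z => j; rewrite dvdzE /= ?NegzE ?mulrNz ?oppr_eq0 -pmulrn nat_case.
Qed.

Lemma Zp_lincomb_eq0 J (r : seq J) (k : J -> 'I_N) (c : J -> int) :
  (\sum_(j <- r) k j *~ c j == 0) = (N%:Z %| \sum_(j <- r) (k j)%:Z * c j)%Z.
Proof.
rewrite -Zp_mulrz_eq0 mulrz_sumr; congr (_ == _); apply: eq_bigr => j _.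
rewrite mulrzA -pmulrn Zp_mulrn; congr (_ *~ _).
by apply: val_inj; rewrite /= modnMml mul1n modn_small.
Qed.

Lemma prim_root_exprz (F : fieldType) (q : F) (z : int) :
  N.-primitive_root q -> (q ^ z == 1) = (N%:Z %| z)%Z.
Proof.
move=> qN; case: z => j; first by rewrite -exprnP -(prim_order_dvd qN).
by rewrite dvdzE -[q ^ _]/(q ^- j.+1) invr_eq1 -(prim_order_dvd qN).
Qed.

Lemma prim_root_exprz2 (F : fieldType) (q : F) (z : int) : odd N ->
  N.-primitive_root q -> (q ^ (2 * z) == 1) = (N%:Z %| z)%Z.
Proof.
move=> oddN qN; rewrite (prim_root_exprz _ qN) Gauss_dvdzr //.
by rewrite coprimezE coprime_sym coprime2n.
Qed.
End Zmod.

Section TorusRepresentation.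
Variables (F : numClosedFieldType) (n N' : nat) (q : F).
Variable sigma : 'I_n -> 'I_n -> int.
Local Notation N := N'.+1.
Hypothesis sigmaN : forall i j, sigma j i = - sigma i j.
Hypothesis qN : N.-primitive_root q.

Local Notation rels := (cf_rels q sigma).
Local Notation X := (cfX q sigma).
Local Notation XV := (cfXV q sigma).
Local Notation weyln := (weyln q sigma).
Local Notation sform := (sform sigma).

Lemma prim_root_neq0 : q != 0.
Proof.
apply/eqP => q0; have := prim_expr_order qN.
by rewrite q0 expr0n => /eqP; rewrite eq_sym oner_eq0.
Qed.
Let q0 := prim_root_neq0.

Lemma cfX_XV e : X e * XV e = 1.
Proof.
rewrite /GRing.mul /GRing.one /= pres_mulE.
by apply/pres_classP/cong_rel/(@cf_rel_inv _ _ _ _ e true).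
Qed.

Lemma cfXV_X e : XV e * X e = 1.
Proof.
rewrite /GRing.mul /GRing.one /= pres_mulE.
by apply/pres_classP/cong_rel/(@cf_rel_inv _ _ _ _ e false).
Qed.

Section Weights.
Variables (V : vectType F) (rho : representation rels V) (x : 'I_n -> F).
Hypothesis x0 : forall e, x e != 0.
Hypothesis rhoX : forall e, acts_by rho (X e ^+ N) (x e).

Local Notation A := {ffun 'I_n -> 'I_N}.
(** The projective representation of the exponent group modulo N. *)
Definition torus_op (k : A) : 'End(V) := rho (weyln (fun i => k i)).
Local Notation U := torus_op.

Lemma rep_weyln_scale k :
  acts_by rho (weyln (fun i => N * k i)%N) (\prod_i x i ^+ k i).
Proof.
rewrite weyln_scale ?prim_expr_order //.
by apply: rep_prod_scalar => i; apply: repX_scalar.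
Qed.

Lemma rep_weylnM k l : (rho (weyln k) \o rho (weyln l))%VF
  = q ^ (sform k l) *: rho (weyln (fun i => k i + l i)%N).
Proof. by rewrite -repM weylnM // repZ. Qed.

(** Reducing exponents modulo N only costs a nonzero scalar, because monomials
    with exponents divisible by N act by products of the x_i. *)
Lemma torus_mod k :
  exists2 z, z != 0 & rho (weyln k) = z *: U [ffun i => inZp (k i)].
Proof.
(* k = N * c + k', and the monomial of N * c is scalar *)
pose k' i := (k i %% N)%N; pose c i := (k i %/ N)%N.
exists (q ^ (- sform (fun i => N * c i)%N k') * \prod_i x i ^+ c i).
  rewrite mulf_neq0 ?expfz_neq0 //.
  by apply/prodf_neq0 => i _; rewrite expf_neq0.
have -> : U [ffun i => inZp (k i)] = rho (weyln k').
  by congr (rho _); apply: eq_weyln => i; rewrite ffunE.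
have := rep_weylnM (fun i => N * c i)%N k'.
rewrite rep_weyln_scale -comp_lfunZl comp_lfun1l => scaleE.
rewrite -scalerA scaleE scalerA -expfzDr // addNr expr0z scale1r.
by congr (rho _); apply: eq_weyln => i; rewrite mulnC -divn_eq.
Qed.

Lemma torus_op0 : U 0 = \1%VF.
Proof.
rewrite -(rep1 rho) -(weyln0 q sigma); congr (rho _); apply: eq_weyln => i.
by rewrite ffunE.
Qed.

Lemma torus_opD k l : exists2 z, z != 0 & (U k \o U l)%VF = z *: U (k + l).
Proof.
rewrite rep_weylnM.
have [z z0 ->] := torus_mod (fun i => k i + l i)%N.
exists (q ^ sform (fun i => k i) (fun i => l i) * z).
  by rewrite mulf_neq0 // expfz_neq0.
rewrite scalerA; congr (_ *: U _); apply/ffunP => i; rewrite !ffunE.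
exact/val_inj.
Qed.

Lemma rep_cfXV e : rho (XV e) = (x e)^-1 *: rho (X e ^+ N').
Proof.
have -> : X e ^+ N' = X e ^+ N * XV e.
  by rewrite exprSr -mulrA cfX_XV mulr1.
rewrite repM rhoX -comp_lfunZl comp_lfun1l scalerA mulVf ?scale1r //.
Qed.

(** Refinement of [rep_ind]: the inverse generators come for free, since
    X_e^-1 acts as X_e^(N-1) up to a scalar. *)
Lemma torus_ind (Q : 'End(V) -> Prop) :
    Q \1%VF -> (forall z f g, Q f -> Q g -> Q (z *: f + g)) ->
    (forall f g, Q f -> Q g -> Q (f \o g)%VF) ->
    (forall k, Q (U k)) ->
  forall a, Q (rho a).
Proof.
move=> Q1 QZD QM QU.
have Q0 : Q 0 by rewrite -(addNr \1%VF) -scaleN1r; apply: QZD.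
have QZ z f : Q f -> Q (z *: f).
  by move=> Qf; rewrite -[_ *: _]addr0; apply: QZD.
have QX e : Q (rho (X e)).
  rewrite -weyln_gen; have [z _ ->] := torus_mod (fun i => i == e : nat).
  exact: QZ.
have QXk e k : Q (rho (X e ^+ k)).
  by elim: k => [|k IHk]; rewrite ?expr0 ?rep1 // exprS repM; apply: QM.
apply: rep_ind => // -[e []]; first exact: QX.
by rewrite [rho _](rep_cfXV e); apply: QZ.
Qed.

Lemma torus_stable (W : {vspace V}) :
  (forall k, (U k @: W <= W)%VS) -> forall a, (rho a @: W <= W)%VS.
Proof.
move=> WU a; apply/stable_lfunP.
apply: (torus_ind (Q := fun f => forall w, w \in W -> f w \in W)).
- by move=> w; rewrite id_lfunE.
- move=> z f g fW gW w Ww; rewrite add_lfunE scale_lfunE.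
  by rewrite memvD ?memvZ ?fW ?gW.
- by move=> f g fW gW w Ww; rewrite comp_lfunE fW // gW.
- by move=> k; apply/stable_lfunP.
Qed.

Lemma torus_comm (g : 'End(V)) :
    (forall k, (U k \o g)%VF = (g \o U k)%VF) ->
  forall a, (rho a \o g)%VF = (g \o rho a)%VF.
Proof.
move=> gU; apply: (torus_ind (Q := fun f => (f \o g)%VF = (g \o f)%VF)) => //.
- by rewrite comp_lfun1l comp_lfun1r.
- by move=> z f h fg hg; rewrite comp_lfunDl comp_lfunDr -comp_lfunZl
    -comp_lfunZr fg hg.
- by move=> f h fg hg; rewrite -comp_lfunA hg !comp_lfunA fg.
Qed.

Hypothesis oddN : odd N.
Hypothesis irr : irreducible_rep rho.

Lemma dim_irreducible_gt0 : (0 < \dim {:V})%N.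
Proof. by rewrite lt0n dimv_eq0; apply/eqP; case: irr. Qed.

(** Exponent vectors of the monomials that are central modulo N. *)
Definition torus_radical : {pred A} :=
  [pred k : A | [forall i, \sum_j k j *~ sigma i j == 0]].

Lemma sform_gen i (k : 'I_n -> nat) :
  sform (fun j => j == i : nat) k = \sum_j (k j)%:Z * sigma i j.
Proof.
rewrite /sform (bigD1 i) //= eqxx [X in _ + X]big1 ?addr0 => [|j /negPf ji].
  by apply: eq_bigr => j _; rewrite mul1r.
by rewrite big1 // => l _; rewrite ji !mul0r.
Qed.

Lemma sformE (l k : 'I_n -> nat) :
  sform l k = \sum_i (l i)%:Z * \sum_j (k j)%:Z * sigma i j.
Proof.
apply: eq_bigr => i _; rewrite mulr_sumr; apply: eq_bigr => j _.
by rewrite mulrA.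
Qed.

Lemma torus_radicalP (k : A) :
  k \in torus_radical <-> forall l, (U l \o U k)%VF = (U k \o U l)%VF.
Proof.
have qcomm l : (rho (weyln l) \o U k)%VF
    = q ^ (2 * sform l (fun i => k i)) *: (U k \o rho (weyln l))%VF.
  by rewrite -!repM weyln_comm // repZ.
split=> [/forallP kR l | kC].
  rewrite {1}/U qcomm; apply/eqP; rewrite -[X in _ == X]scale1r; apply/eqP.
  congr (_ *: _); apply/eqP; rewrite (prim_root_exprz2 _ oddN qN) sformE.
  apply: rpred_sum => i _; apply: dvdz_mull.
  by have := kR i; rewrite Zp_lincomb_eq0.
apply/forallP => i; rewrite Zp_lincomb_eq0 -sform_gen.
rewrite -(prim_root_exprz2 _ oddN qN).
have := torus_comm (g := U k) kC (weyln (fun j => j == i : nat)).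
rewrite qcomm => /eqP; rewrite -{2}[(_ \o _)%VF]scale1r -subr_eq0 -scalerBl.
rewrite scaler_eq0 subr_eq0 => /orP[//|/eqP UX].
have [z z0 zE] := torus_mod (fun j => j == i : nat).
have := dim_irreducible_gt0; rewrite lt0n -(eqr_nat F) -lftrace1.
have lk0 l := proj_lker0 torus_op0 torus_opD l.
have : (z^-1 *: (U k \o rho (weyln (fun j => j == i : nat))))%VF = 0.
  by rewrite UX scaler0.
rewrite zE -comp_lfunZr scalerA mulVf // scale1r => UU0.
move/(congr1 (comp_lfun (U k)^-1%VF)): UU0.
rewrite lker0_compKf // comp_lfun0r.
move/(congr1 (comp_lfun (U [ffun j => inZp (j == i)])^-1%VF)).
by rewrite lker0_compVf // comp_lfun0r => ->; rewrite linear0 eqxx.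
Qed.

(** The instance of [irreducible_dim] for the exponent group modulo N. *)
Theorem torus_irreducible_dim : (\dim {:V} ^ 2 * #|torus_radical| = N ^ n)%N.
Proof.
rewrite (irreducible_dim torus_op0 torus_opD) //.
- by rewrite card_ffun !card_ord.
- by move=> g gU; apply: schur_rep irr _; apply: torus_comm.
- exact: dim_irreducible_gt0.
- exact: torus_radicalP.
Qed.

End Weights.
End TorusRepresentation.

(** * Complete reducibility *)

Section Subrepresentations.
Variables (F : fieldType) (I : Type).
Variable rels : pres_expr F I -> pres_expr F I -> Prop.
Variables (V : vectType F) (rho : representation rels V).
Local Notation A := (presented_algebra rels).

Definition subrep (W : {vspace V}) : Prop := forall a, (rho a @: W <= W)%VS.

(** Irreducibility of a submodule, expressed inside V. *)
Definition simple_subrep (W : {vspace V}) : Prop :=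
  [/\ subrep W, W <> 0%VS &
      forall U, subrep U -> (U <= W)%VS -> U = 0%VS \/ U = W].

Lemma subrep_cap U W : subrep U -> subrep W -> subrep (U :&: W)%VS.
Proof.
move=> sU sW a; apply/stable_lfunP => w /memv_capP[Uw Ww].
by apply/memv_capP; split; apply: (stable_lfunP _ _ _ w) => //.
Qed.

Section Restriction.
Variables (W : {vspace V}) (sW : subrep W).

Definition restrict_fun (a : A) : 'End(subvs_of W) :=
  (linfun (vsproj W) \o rho a \o linfun vsval)%VF.

Lemma restrict_funE a w : vsval (restrict_fun a w) = rho a (vsval w).
Proof.
rewrite !comp_lfunE !lfunE /= vsprojK //.
by apply: (stable_lfunP _ _ (sW a)); apply: subvsP.
Qed.

Lemma restrict_linear : linear restrict_fun.
Proof.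
move=> z a b; apply/lfunP => w; apply/subvs_inj.
rewrite add_lfunE scale_lfunE linearP /= !restrict_funE repD repZ.
by rewrite add_lfunE scale_lfunE.
Qed.

Lemma restrict1 : restrict_fun 1 = \1%VF.
Proof.
by apply/lfunP => w; apply/subvs_inj; rewrite restrict_funE rep1 !id_lfunE.
Qed.

Lemma restrictM a b :
  restrict_fun (a * b) = (restrict_fun a \o restrict_fun b)%VF.
Proof.
apply/lfunP => w; apply/subvs_inj.
by rewrite comp_lfunE !restrict_funE repM comp_lfunE.
Qed.

Definition restriction : representation rels (subvs_of W) :=
  Representation restrict_linear restrict1 restrictM.

Lemma restriction_is_restriction : is_restriction rho restriction.
Proof. exact: restrict_funE. Qed.

Lemma restriction_acts_by a z : acts_by rho a z -> acts_by restriction a z.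
Proof.
move=> az; apply/lfunP => w; apply/subvs_inj.
by rewrite restrict_funE az !scale_lfunE !id_lfunE.
Qed.

Lemma acts_by_on_subrep a z w :
  acts_by restriction a z -> w \in W -> rho a w = z *: w.
Proof.
move=> az Ww; rewrite -[w in LHS](vsprojK Ww) -restrict_funE.
rewrite -[restrict_fun a]/(restriction a) az scale_lfunE id_lfunE linearZ /=.
by rewrite vsprojK.
Qed.

Lemma dim_subvs : \dim {: subvs_of W} = \dim W.
Proof. by rewrite dimvf. Qed.

Lemma restriction_irreducible : simple_subrep W -> irreducible_rep restriction.
Proof.
case=> _ W0 Wsimple; split.
  by move/eqP; rewrite -dimv_eq0 dim_subvs dimv_eq0 => /eqP.
move=> U sU; pose i : 'Hom(subvs_of W, V) := linfun vsval.
have i0 : lker i == 0%VS.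
  by apply/lker0P => u v; rewrite !lfunE => /subvs_inj.
have dimi X : \dim (i @: X) = \dim X.
  by apply: limg_dim_eq; rewrite (eqP i0) capv0.
have [a||iU0|iUW] := Wsimple (i @: U)%VS.
- apply/stable_lfunP => _ /memv_imgP[u Uu ->].
  rewrite lfunE /= -restrict_funE -[vsval _]lfunE memv_img //.
  exact: (stable_lfunP _ _ (sU a)).
- by apply/subvP => _ /memv_imgP[u Uu ->]; rewrite lfunE subvsP.
- by left; apply/eqP; rewrite -dimv_eq0 -dimi iU0 dimv0.
right; apply/eqP.
by rewrite eqEdim subvf -[X in (_ <= X)%N]dimi iUW dim_subvs /= leqnn.
Qed.

End Restriction.

Hypothesis complemented : forall W, subrep W -> exists C,
  [/\ subrep C, (W + C)%VS = fullv & (W :&: C)%VS = 0%VS].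

Lemma simple_subrep_exists X :
  subrep X -> X <> 0%VS -> exists2 W, simple_subrep W & (W <= X)%VS.
Proof.
move=> sX X0.
(* a nonzero subrepresentation of least dimension is simple *)
pose P k := `[< exists W, [/\ subrep W, W <> 0%VS, (W <= X)%VS & \dim W = k] >].
have exP : exists k, P k by exists (\dim X); apply/asboolP; exists X.
case: (ex_minnP exP) => k /asboolP[W [sW W0 WX dW]] kmin.
exists W => //; split=> // U sU UW.
have [->|/eqP U0] := eqVneq U 0%VS; [by left | right; apply/eqP].
rewrite eqEdim UW dW; apply: kmin; apply/asboolP; exists U; split=> //.
exact: subv_trans WX.
Qed.

Lemma semisimple X : subrep X -> exists s : seq {vspace V},
  [/\ forall W, W \in s -> simple_subrep W, (\sum_(W <- s) W)%VS = X
    & \sum_(W <- s) \dim W = \dim X].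
Proof.
move: {2}(\dim X) (leqnn (\dim X)) => d; elim: d X => [|d IHd] X.
  rewrite leqn0 dimv_eq0 => /eqP -> _.
  by exists [::]; split; rewrite ?big_nil ?dimv0.
have [-> _ _|/eqP X0 dX sX] := eqVneq X 0%VS.
  by exists [::]; split; rewrite ?big_nil ?dimv0.
have [W simW WX] := simple_subrep_exists sX X0; have [sW W0 _] := simW.
have [C [sC WC1 WC0]] := complemented sW.
have capW : (W :&: (C :&: X) = 0)%VS by rewrite capvA WC0 cap0v.
have sumW : (W + (C :&: X) = X)%VS by rewrite vspace_modl // WC1 capfv.
have dimX : (\dim W + \dim (C :&: X) = \dim X)%N.
  by rewrite -dimv_disjoint_sum // sumW.
have dW : (0 < \dim W)%N by rewrite lt0n dimv_eq0; apply/eqP.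
have [||s [simS sumS dimS]] := IHd (C :&: X)%VS.
- by rewrite -ltnS (leq_trans _ dX) // -dimX -[X in (X < _)%N]add0n ltn_add2r.
- exact: subrep_cap.
exists (W :: s); split; rewrite ?big_cons ?sumS ?dimS //.
by move=> U; rewrite inE => /orP[/eqP -> // | /simS].
Qed.

End Subrepresentations.

Section TorusWeights.
Variables (F : numClosedFieldType) (n N' : nat) (q : F).
Variable sigma : 'I_n -> 'I_n -> int.
Local Notation N := N'.+1.
Hypothesis sigmaN : forall i j, sigma j i = - sigma i j.
Hypothesis qN : N.-primitive_root q.
Local Notation rels := (cf_rels q sigma).
Local Notation X := (cfX q sigma).
Local Notation XV := (cfXV q sigma).
Variables (V : vectType F) (rho : representation rels V).

Lemma torus_complemented (x : 'I_n -> F) :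
    (forall e, x e != 0) -> (forall e, acts_by rho (X e ^+ N) (x e)) ->
  forall W, subrep rho W -> exists C,
    [/\ subrep rho C, (W + C)%VS = fullv & (W :&: C)%VS = 0%VS].
Proof.
move=> x0 rhoX W sW.
have [k|C [sC WC1 WC0]] := maschke (torus_op0 N' rho)
  (torus_opD sigmaN qN x0 rhoX) (W := W); first exact: sW.
by exists C; split=> //; apply: torus_stable rhoX _ sC.
Qed.

(** The commutation factor of X_i with X_e^N is a power of q^N = 1. *)
Lemma cfX_power_central e a : irreducible_rep rho ->
  (rho a \o rho (X e ^+ N))%VF = (rho (X e ^+ N) \o rho a)%VF.
Proof.
move=> irr; apply: (rep_ind (Q := fun f =>
  (f \o rho (X e ^+ N))%VF = (rho (X e ^+ N) \o f)%VF)).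
- by rewrite comp_lfun1l comp_lfun1r.
- by move=> z f h fg hg; rewrite comp_lfunDl comp_lfunDr -comp_lfunZl
    -comp_lfunZr fg hg.
- by move=> f h fg hg; rewrite -comp_lfunA hg !comp_lfunA fg.
have XC i : X i * X e ^+ N = X e ^+ N * X i.
  have := qcommX 1 N (cfX_comm q sigma i e).
  rewrite !expr1 mul1n; have -> : (q ^ (2 * sigma i e)) ^+ N = 1.
    rewrite exprnP exprz_exp mulrC -exprz_exp -exprnP prim_expr_order //.
    by rewrite exp1rz.
  by rewrite scale1r.
move=> [i [|]]; rewrite -!repM; congr (rho _); first exact: XC.
rewrite -/(XV i) -[LHS]mulr1 -(cfX_XV q sigma i) mulrA -(mulrA (XV i)) -XC.
by rewrite mulrA cfXV_X mul1r.
Qed.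

(** An irreducible representation of a triangle algebra comes without prescribed
    weights; Schur's lemma provides them. *)
Lemma irreducible_weights : irreducible_rep rho -> exists x : 'I_n -> F,
  (forall e, x e != 0) /\ (forall e, acts_by rho (X e ^+ N) (x e)).
Proof.
move=> irr.
have /fin_all_exists[x xE] : forall e, exists z, acts_by rho (X e ^+ N) z.
  move=> e; apply: (@schur_rep _ _ _ _ rho (rho (X e ^+ N))) => // a.
  exact: cfX_power_central.
exists x; split=> // e; apply/eqP => xe0.
have XXV k : X e ^+ k * XV e ^+ k = 1.
  elim: k => [|k IHk]; first by rewrite !expr0 mulr1.
  by rewrite exprSr exprS mulrA -[_ * X e * _]mulrA cfX_XV mulr1.
have := dim_irreducible_gt0 irr.
rewrite lt0n -(eqr_nat F) -lftrace1 -(rep1 rho) -(XXV N) repM xE xe0 scale0r.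
by rewrite comp_lfun0l linear0 eqxx.
Qed.

End TorusWeights.

(** * Triangulations and the radical of the Fock matrix *)

Section Sides.
Variable m : nat.
Implicit Types a : side m.

Lemma next_sideK : cancel (@next_side m) (@prev_side m).
Proof. by case=> f i; rewrite /prev_side /= ordSK. Qed.

Lemma prev_sideK : cancel (@prev_side m) (@next_side m).
Proof. by case=> f i; rewrite /next_side /= ord_predK. Qed.

Lemma next_next a : next_side (next_side a) = prev_side a.
Proof.
case: a => f i; congr (_, _); apply/val_inj.
by case: i => [[|[|[|]]]].
Qed.

Lemma prev_prev a : prev_side (prev_side a) = next_side a.
Proof. by rewrite -next_next !prev_sideK. Qed.
End Sides.

Section Triangulation.
Variables (g s m n : nat) (lam : ideal_triangulation g s m n).
Local Notation edge := (edge lam).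
Local Notation opp := (Defs.opp lam).
Local Notation punct := (punct lam).
Implicit Types a b : side m.

Lemma edge_opp a : edge (opp a) = edge a.
Proof. by apply/eqP; rewrite edge_eq oppK eqxx orbT. Qed.

(** The corners at the two ends of a side a are a and [prev_side a]; the gluing
    identifies the second one with the corner of [opp a]. *)
Lemma punct_prev a : punct (prev_side a) = punct (opp a).
Proof.
apply/esym/eqP; rewrite punct_eq; apply/connect1.
by rewrite /next_corner /frel /= oppK.
Qed.

Lemma punct_prev_opp a : punct (prev_side (opp a)) = punct a.
Proof. by rewrite punct_prev oppK. Qed.

Lemma sum_edge (Z : nmodType) a (f : side m -> Z) :
  \sum_(b | edge b == edge a) f b = f a + f (opp a).
Proof.
rewrite (bigD1 a) //= (bigD1 (opp a)) /=; last first.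
  by rewrite edge_opp eqxx opp_neq.
rewrite big1 ?addr0 // => b /andP[/andP[]].
by rewrite eq_sym edge_eq => /orP[] ->; rewrite ?andbF.
Qed.

Lemma fockN i j : fock lam j i = - fock lam i j.
Proof. by rewrite /fock opprB. Qed.

Section Potentials.
Variable Z : zmodType.
Implicit Types (k : 'I_n -> Z) (w : 'I_s -> Z).

(** The row e of the Fock matrix, read off the two faces adjacent to e: on each
    of them, the difference between the next side and the previous one. *)
Lemma fock_sum k e : \sum_j k j *~ fock lam e j
  = \sum_(a | edge a == e) (k (edge (next_side a)) - k (edge (prev_side a))).
Proof.
rewrite sumrB /fock.
under eq_bigr => j _ do rewrite mulrzBr -!pmulrn /sectors.
rewrite sumrB; congr (_ - _).
  rewrite [RHS](partition_big (fun a => edge (next_side a)) predT) //=.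
  apply: eq_bigr => j _; rewrite -sumr_const; apply: eq_big => a.
    by rewrite inE.
  by rewrite inE => /andP[_ /eqP ->].
rewrite [RHS](reindex_inj (can_inj (@next_sideK m))) /=.
under [RHS]eq_bigr do rewrite next_sideK.
rewrite [RHS](partition_big edge predT) //=.
apply: eq_bigr => j _; rewrite -sumr_const; apply: eq_big => a.
  by rewrite inE andbC.
by rewrite inE => /andP[/eqP ->].
Qed.

(** The edge weights of the multicurve with w v parallel loops around each v. *)
Definition loop_sum w (e : 'I_n) : Z := \sum_v w v *+ punct_mult lam v e.

Lemma loop_sumE w a :
  loop_sum w (edge a) = w (punct a) + w (punct (prev_side a)).
Proof.
rewrite punct_prev -(sum_edge a (fun b => w (punct b))).
rewrite (partition_big punct predT) //=; apply: eq_bigr => v _.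
rewrite -sumr_const; apply: eq_big => b; first by rewrite inE.
by rewrite inE => /andP[_ /eqP ->].
Qed.

Lemma loop_sum_next_prev w a :
  loop_sum w (edge (next_side a)) - loop_sum w (edge (prev_side a))
  = w (punct a) - w (punct (prev_side a)).
Proof.
rewrite !loop_sumE next_sideK prev_prev.
by rewrite [w (punct (next_side a)) + _]addrC
  [w _ + w (punct (next_side a))]addrC addrKA.
Qed.

(** The two faces along an edge contribute opposite differences of the values of
    w at its ends. *)
Lemma loop_sum_central w e : \sum_j loop_sum w j *~ fock lam e j = 0.
Proof.
have [a <-] := edge_surj lam e; rewrite fock_sum sum_edge.
by rewrite !loop_sum_next_prev punct_prev_opp punct_prev subrKA subrr.
Qed.

(** Going around a triangle, the edge weights determine twice the corner
    weights; when 2 is invertible, they determine w. *)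
Lemma loop_sum_corner w a :
  loop_sum w (edge a) + loop_sum w (edge (next_side a))
    - loop_sum w (edge (prev_side a)) = w (punct a) *+ 2.
Proof.
by rewrite -addrA loop_sum_next_prev loop_sumE addrACA subrr addr0 mulr2n.
Qed.

Variable h : nat.
Hypothesis halfK : forall z : Z, z *+ 2 *+ h = z.

Lemma loop_sum_inj w w' : loop_sum w =1 loop_sum w' -> w =1 w'.
Proof.
move=> ww' v; have [a <-] := punct_surj lam v.
by rewrite -[LHS]halfK -[RHS]halfK -!loop_sum_corner !ww'.
Qed.

(** The hypothesis makes the edge weights constant on each face, hence
    everywhere by connectedness, and [loop_sum_corner] then determines w. *)
Lemma loop_sum_constant w :
  (forall a, loop_sum w (edge (next_side a)) = loop_sum w (edge (prev_side a)))
  -> forall v v', w v = w v'.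
Proof.
move=> wP v v'; set k := loop_sum w in wP.
have k_next a : k (edge (next_side a)) = k (edge a).
  by rewrite -[in LHS](prev_sideK a) next_next -wP prev_sideK.
have k_const a b : k (edge a) = k (edge b).
  have /connectP[p] := connected lam a b.
  elim: p a => [|c p IHp] a /=; first by move=> _ ->.
  case/andP=> /orP[] /eqP -> /IHp{}IHp /IHp <-; first by rewrite k_next.
  by rewrite edge_opp.
have [[a <-] [b <-]] := (punct_surj lam v, punct_surj lam v').
rewrite -[LHS]halfK -[RHS]halfK -!loop_sum_corner -/k.
by rewrite (k_const a b) (k_const (next_side a) b) (k_const (prev_side a) b)
  (k_const (next_side b) b) (k_const (prev_side b) b).
Qed.

(** The corner weights u recovered from k as in [loop_sum_corner] do not change
    from a corner to the next one around the vertex: this is the equation of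
    the radical at the edge crossed. So u descends to the punctures. *)
Lemma fock_radical k :
  (forall e, \sum_j k j *~ fock lam e j = 0) -> exists w, k =1 loop_sum w.
Proof.
move=> kR.
(* multiplication by h stands for division by 2 *)
pose u a :=
  (k (edge a) + k (edge (next_side a)) - k (edge (prev_side a))) *+ h.
have u_corner a : u (next_corner opp a) = u a.
  congr (_ *+ h); rewrite /next_corner prev_sideK prev_prev edge_opp.
  have := kR (edge a); rewrite fock_sum sum_edge => /eqP.
  rewrite addr_eq0 opprB => /eqP kE; rewrite -[RHS]addrA kE.
  by rewrite addrCA addrA.
have u_punct a b : punct a = punct b -> u a = u b.
  move/eqP; rewrite punct_eq => /iter_findex <-.
  by elim: (findex _ _ _) => //= i IHi; rewrite u_corner.
have /fin_all_exists[c cE] := punct_surj lam.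
exists (fun v => u (c v)) => e; have [a <-] := edge_surj lam e.
rewrite loop_sumE !(u_punct _ _ (cE _)) -mulrnDl prev_sideK prev_prev.
rewrite -[LHS]halfK; congr (_ *+ h).
move: (k (edge a)) (k (edge (next_side a))) (k (edge (prev_side a))) => x y z.
by rewrite [z + x]addrC -(addrA x y) -(addrA x z) -(opprB y z) addrACA subrr
  addr0 mulr2n.
Qed.

End Potentials.

Lemma card_fock_radical (Z : finZmodType) h :
    (forall z : Z, z *+ 2 *+ h = z) ->
  #|[pred k : {ffun 'I_n -> Z} |
      [forall e, \sum_j k j *~ fock lam e j == 0]]| = (#|Z| ^ s)%N.
Proof.
move=> halfK; pose Phi (w : {ffun 'I_s -> Z}) := [ffun e => loop_sum w e].
have Phi_inj : injective Phi.
  move=> w w' /ffunP ww'; apply/ffunP/(loop_sum_inj halfK) => e.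
  by have := ww' e; rewrite !ffunE.
rewrite -[s in RHS]card_ord -card_ffun -(card_codom Phi_inj).
apply: eq_card => k; rewrite inE; apply/forallP/codomP => [kR | [w ->] e].
  have [e|w kw] := fock_radical halfK (k := k); first exact/eqP.
  exists [ffun v => w v]; apply/ffunP => e; rewrite ffunE kw.
  by apply: eq_bigr => v _; rewrite ffunE.
by under eq_bigr do rewrite ffunE; rewrite loop_sum_central.
Qed.

Lemma card_edge_sides e : #|[pred b | edge b == e]| = 2%N.
Proof.
have [a <-] := edge_surj lam e.
have -> : 2%N = #|pred2 a (Defs.opp lam a)| by rewrite card2 eq_sym opp_neq.
by apply: eq_card => b; rewrite !inE eq_sym edge_eq.
Qed.

Lemma sum_punct_mult e : (\sum_v punct_mult lam v e = 2)%N.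
Proof.
rewrite -(card_edge_sides e) -sum1_card (partition_big punct predT) //=.
apply: eq_bigr => v _; rewrite sum1_card /punct_mult cardsE.
by apply: eq_card => b.
Qed.

(** Each of the 3 sides of each face is one of the two sides of its edge. *)
Lemma card_edges : (m * 3 = 2 * n)%N.
Proof.
have := card_prod 'I_m 'I_3; rewrite !card_ord => <-.
rewrite -sum1_card (partition_big edge predT) //=.
rewrite (eq_bigr (fun=> 2%N)) => [|e _].
  by rewrite sum_nat_const card_ord mulnC.
by rewrite sum1_card; apply: card_edge_sides.
Qed.

End Triangulation.

(** * Multilinear maps and tensor products *)

Section FunctionUpdate.
Variables (I : eqType) (T : I -> Type).
Implicit Types v : forall i, T i.

Lemma dfwith_id v i : dfwith v (v i) = v.
Proof.
apply: functional_extensionality_dep => j.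
by case: (eqVneq i j) => [<-|ij]; rewrite ?dfwith_in ?dfwith_out.
Qed.

Lemma dfwith_idem v i (x y : T i) : dfwith (dfwith v x) y = dfwith v y.
Proof.
apply: functional_extensionality_dep => j.
by case: (eqVneq i j) => [<-|ij]; rewrite ?dfwith_in ?dfwith_out.
Qed.

Lemma dfwithC v i j (x : T i) (y : T j) : i != j ->
  dfwith (dfwith v x) y = dfwith (dfwith v y) x.
Proof.
move=> ij; apply: functional_extensionality_dep => l.
have [il|il] := eqVneq i l; have [jl|jl] := eqVneq j l.
- by rewrite il jl eqxx in ij.
- by rewrite dfwith_out // -il !dfwith_in.
- by rewrite [RHS]dfwith_out // -jl !dfwith_in.
- by rewrite !dfwith_out.
Qed.
End FunctionUpdate.

Section Multilinear.
Variables (F : fieldType) (m : nat) (V_ : 'I_m -> vectType F) (W : vectType F).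
Variable phi : (forall f, V_ f) -> W.
Hypothesis phiP : multilinear_map phi.

Lemma multilinear0 v f : phi (dfwith v (0 : V_ f)) = 0.
Proof.
have := phiP v 1 (0 : V_ f) 0; rewrite !scale1r addr0 => /eqP.
by rewrite -subr_eq0 opprD addrA subrr sub0r oppr_eq0 => /eqP.
Qed.

Lemma multilinearZ v f a (x : V_ f) :
  phi (dfwith v (a *: x)) = a *: phi (dfwith v x).
Proof. by rewrite -[a *: x]addr0 phiP multilinear0 addr0. Qed.

Lemma multilinear_lfun (W' : vectType F) (h : 'Hom(W, W')) :
  multilinear_map (h \o phi).
Proof. by move=> v f a x y; rewrite /= phiP linearP. Qed.

(** The components of v are expanded on the bases one after the other. *)
Lemma multilinear_basis :
    (forall v, (forall f, v f \in vbasis {:V_ f}) -> phi v = 0) ->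
  forall v, phi v = 0.
Proof.
move=> phi0.
(* induction on the number r of leading components that are arbitrary *)
suff P r : forall v, (forall f : 'I_m, (r <= f)%N -> v f \in vbasis {:V_ f}) ->
    phi v = 0.
  by move=> v; apply: (P m) => f; rewrite leqNgt ltn_ord.
elim: r => [|r IHr] v vr; first by apply: phi0 => f; apply: vr.
have [rm|mr] := ltnP r m; last first.
  by apply: IHr => f rf; have := ltn_ord f; rewrite ltnNge (leq_trans mr).
pose f := Ordinal rm; rewrite -[v](dfwith_id v f).
rewrite (coord_vbasis (memvf (v f))).
elim/big_rec: _ => [|i x _ IHx]; first exact: multilinear0.
rewrite phiP IHx addr0; have -> := IHr (dfwith v (vbasis {:V_ f})`_i).
  by rewrite scaler0.
move=> j; rewrite leq_eqVlt => /orP[/eqP rj | rj].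
  have -> : j = f by apply/val_inj.
  by rewrite dfwith_in mem_nth // size_tuple.
rewrite dfwith_out; first exact: vr.
by rewrite -val_eqE /= neq_ltn rj.
Qed.

End Multilinear.

Section TensorProduct.
Variables (F : fieldType) (m : nat) (V_ : 'I_m -> vectType F).
Variables (V : vectType F) (tau : (forall f, V_ f) -> V).
Hypothesis tauP : is_tensor_product tau.

Let tau_multilinear : multilinear_map tau := tauP.1.

(** The uniqueness part of the universal property. *)
Lemma tensor_ext (W : vectType F) (h h' : 'Hom(V, W)) :
  (forall v, h (tau v) = h' (tau v)) -> h = h'.
Proof.
move=> hh'; have [h0 [_ h0uniq]] :=
  tauP.2 _ _ (multilinear_lfun tau_multilinear h').
by rewrite -(h0uniq h) // -(h0uniq h').
Qed.

(** Extension of an operator on one factor by the identity on the others. *)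
Lemma factor_op_exists f (g : 'End(V_ f)) :
  exists h : 'End(V), forall v, h (tau v) = tau (dfwith v (g (v f))).
Proof.
pose phi v := tau (dfwith v (g (v f))).
have phiP : multilinear_map phi.
  move=> v f' a x y; rewrite /phi; have [ff'|ff'] := eqVneq f f'.
    subst f'; rewrite !dfwith_in !dfwith_idem linearP.
    exact: tau_multilinear.
  have f'f : f' != f by rewrite eq_sym.
  by rewrite !dfwith_out // !(dfwithC _ _ _ f'f) tau_multilinear.
by have [h [hE _]] := tauP.2 _ _ phiP; exists h.
Qed.

Section Dimension.
Variable d : nat.
Hypothesis dimV_ : forall f, \dim {:V_ f} = d.
Local Notation J := {ffun 'I_m -> 'I_d}.

Let e (j : J) : V := tau (fun f => (vbasis {:V_ f})`_(j f)).

Let combination (c : {ffun J -> F^o}) : V := \sum_j c j *: e j.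

Let combination_linear : linear combination.
Proof.
move=> a c c'; rewrite /combination scaler_sumr -big_split; apply: eq_bigr.
by move=> j _; rewrite !ffunE scalerDl scalerA.
Qed.
HB.instance Definition _ :=
  GRing.isLinear.Build F {ffun J -> F^o} V _ combination combination_linear.

Let G : 'Hom({ffun J -> F^o}, V) := linfun combination.

(** The multilinear coordinate forms separate the elementary tensors of basis
    vectors, which are therefore linearly independent. *)
Let dual_exists (j : J) : exists h : 'Hom(V, F^o),
  forall j' : J, h (e j') = (j == j')%:R.
Proof.
pose co f (x : V_ f) : F^o :=
  coord (vbasis {:V_ f}) (cast_ord (esym (dimV_ f)) (j f)) x.
(* the product of the coordinate forms of the basis vectors chosen by j *)
pose phi (v : forall f, V_ f) : F^o := \prod_f co f (v f).
have phiP : multilinear_map phi.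
  move=> v f a x y.
  have phiE z : phi (dfwith v z)
      = co f z * \prod_(i < m | i != f) co i (v i).
    rewrite /phi (bigD1 f) //= dfwith_in; congr (_ * _).
    by apply: eq_bigr => i fi; rewrite dfwith_out // eq_sym.
  by rewrite !phiE /co linearP mulrDl -mulrA.
have [h [hE _]] := tauP.2 _ _ phiP; exists h => j'; rewrite /e hE /phi.
have coE f : co f (vbasis {:V_ f})`_(j' f) = (j f == j' f)%:R.
  rewrite /co (coord_free (cast_ord (esym (dimV_ f)) (j' f)));
    last exact: basis_free (vbasisP _).
  by rewrite -val_eqE eq_sym.
rewrite (eq_bigr _ (fun f _ => coE f)).
have [->|jj'] := eqVneq j j'; first by rewrite big1 // => f _; rewrite eqxx.
have [f /negPf jf] : exists f, j f != j' f.
  by apply/existsP; rewrite -negb_forall; apply: contra jj' => /forallP jE;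
    apply/eqP/ffunP => f; apply/eqP.
by rewrite (bigD1 f) //= jf mul0r.
Qed.

Lemma tensor_dim : \dim {:V} = (d ^ m)%N.
Proof.
have G_inj : lker G == 0%VS.
  apply/lker0P => c c'; rewrite !lfunE /= => cc'; apply/ffunP => j.
  have [h hE] := dual_exists j.
  have hc c0 : h (combination c0) = c0 j.
    rewrite linear_sum (bigD1 j) //= linearZ /= hE eqxx big1 ?addr0.
      exact: mulr1.
    move=> j' j'j; rewrite linearZ /= hE eq_sym (negPf j'j).
    exact: mulr0.
  by rewrite -hc cc' hc.
have G_full : limg G = fullv.
  suff P0 : (\1 - projv (limg G))%VF = 0 :> 'End(V).
    apply/eqP; rewrite eqEsubv subvf; apply/subvP => u _.
    have : (\1 - projv (limg G))%VF u = 0 by rewrite P0 zero_lfunE.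
    rewrite add_lfunE opp_lfunE id_lfunE => /eqP; rewrite subr_eq0 => /eqP ->.
    exact: memv_proj.
  apply: tensor_ext => v; rewrite zero_lfunE; move: v.
  apply: (multilinear_basis (multilinear_lfun tau_multilinear
    (\1 - projv (limg G))%VF)) => v vb /=.
  have vlt f : (index (v f) (vbasis {:V_ f}) < d)%N.
    by have := vb f; rewrite -index_mem size_tuple [X in (_ < X)%N]dimV_.
  pose j : J := [ffun f => Ordinal (vlt f)].
  have -> : tau v = G [ffun j' => (j' == j)%:R].
    rewrite lfunE /= /combination (bigD1 j) //= ffunE eqxx scale1r.
    rewrite big1 ?addr0 => [|j' /negPf j'j]; last by rewrite ffunE j'j scale0r.
    congr tau; apply: functional_extensionality_dep => f.
    by rewrite ffunE /= nth_index // vb.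
  rewrite add_lfunE opp_lfunE id_lfunE projv_id ?subrr //.
  by rewrite memv_img ?memvf.
rewrite -G_full limg_dim_eq ?(eqP G_inj) ?capv0 // dimvf.
have -> : dim {ffun J -> F^o} = (#|J| * 1)%N by [].
by rewrite muln1 card_ffun !card_ord.
Qed.
End Dimension.

End TensorProduct.

(** * Local representations *)

Lemma triangle_sigmaN i j : triangle_sigma j i = - triangle_sigma i j.
Proof. by rewrite /triangle_sigma opprB. Qed.

Lemma triangle_sum (Z : zmodType) (k : 'I_3 -> Z) i :
  \sum_j k j *~ triangle_sigma i j = k (ordS i) - k (ord_pred i).
Proof.
have pick j0 : \sum_j k j *+ (j == j0) = k j0.
  by rewrite (bigD1 j0) //= eqxx big1 ?addr0 // => j /negPf ->.
rewrite -(pick (ordS i)) -(pick (ord_pred i)) -sumrB; apply: eq_bigr => j _.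
rewrite /triangle_sigma mulrzBr -!pmulrn (eq_sym i).
by rewrite (can2_eq (@ordSK _) (@ord_predK _)).
Qed.

Lemma ordSS (i : 'I_3) : ordS (ordS i) = ord_pred i.
Proof. by apply/val_inj; case: i => [[|[|[|]]]]. Qed.

Lemma card_triangle_radical (Z : finZmodType) :
  #|[pred k : {ffun 'I_3 -> Z} |
      [forall i, \sum_j k j *~ triangle_sigma i j == 0]]| = #|Z|.
Proof.
pose cst (z : Z) : {ffun 'I_3 -> Z} := [ffun=> z].
have cst_inj : injective cst.
  by move=> y z /ffunP/(_ ord0); rewrite !ffunE.
rewrite -(card_codom cst_inj); apply: eq_card => k; rewrite inE.
apply/forallP/codomP => [kR | [z ->] i]; last first.
  by rewrite triangle_sum !ffunE subrr.
have kS i : k (ordS i) = k i.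
  have := kR i; have := kR (ordS i); rewrite !triangle_sum ordSS ordSK.
  by rewrite !subr_eq0 => /eqP -> /eqP.
exists (k ord0); apply/ffunP => i; rewrite ffunE.
have [->|[->|->]] : i = ord0 \/ i = ordS ord0 \/ i = ordS (ordS ord0).
- by case: i => [[|[|[|]]]] // ilt; [left|right; left|right; right];
    apply/val_inj.
- by [].
- exact: kS.
- by rewrite !kS.
Qed.

Lemma Zp_halfK N' (z : 'I_N'.+1) :
  odd N'.+1 -> z *+ 2 *+ (N'./2).+1 = z.
Proof.
move=> oddN; rewrite -mulrnA.
have -> : (2 * (N'./2).+1 = N'.+1 + 1)%N.
  by have := odd_double_half N'; move: oddN => /= /negPf ->; lia.
rewrite Zp_mulrn mulnDr muln1; apply: val_inj.
by rewrite /= modnMDl modn_small.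
Qed.

Section QCommutation.
Variables (F : fieldType) (n : nat) (q : F) (sigma : 'I_n -> 'I_n -> int).
Hypothesis q0 : q != 0.
Variables (V : vectType F) (rho : representation (cf_rels q sigma) V).

(** Commutation factors with the generators determine those with monomials. *)
Lemma qcomm_weyln (Y : 'End(V)) (c : 'I_n -> int) :
  (forall e, (Y \o rho (cfX q sigma e))%VF
    = q ^ c e *: (rho (cfX q sigma e) \o Y)%VF) ->
  forall k : 'I_n -> nat, (Y \o rho (weyln q sigma k))%VF
    = q ^ (\sum_e (k e)%:Z * c e) *: (rho (weyln q sigma k) \o Y)%VF.
Proof.
move=> YX k.
have YXk e j : (Y \o rho (cfX q sigma e ^+ j))%VF
    = q ^ (j%:Z * c e) *: (rho (cfX q sigma e ^+ j) \o Y)%VF.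
  elim: j => [|j IHj].
    by rewrite expr0 rep1 mul0r expr0z scale1r comp_lfun1l comp_lfun1r.
  rewrite exprS repM comp_lfunA YX -comp_lfunZl -(comp_lfunA _ Y) IHj.
  rewrite -comp_lfunZr scalerA -expfzDr // comp_lfunA; congr (q ^ _ *: _).
  by rewrite -addn1 PoszD; ring.
rewrite weylnE !repZ -comp_lfunZr -comp_lfunZl scalerA mulrC -scalerA.
congr (_ *: _).
rewrite expfz_sum //; elim: (index_enum _) => [|e r IHr].
  by rewrite !big_nil rep1 scale1r comp_lfun1l comp_lfun1r.
rewrite !big_cons repM comp_lfunA YXk -comp_lfunZl -(comp_lfunA _ Y) IHr.
by rewrite -comp_lfunZr scalerA comp_lfunA.
Qed.
End QCommutation.

Section LocalRepresentation.
Variables (g s m n : nat) (lam : ideal_triangulation g s m n).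
Variables (F : numClosedFieldType) (N' : nat) (q : F).
Local Notation N := N'.+1.
Hypothesis qN : N.-primitive_root q.
Hypothesis oddN : odd N.
Variables (V : vectType F) (rho : cf_rep lam q V).
Hypothesis rho_local : local_rep rho.

Let q0 : q != 0 := prim_root_neq0 qN.

(** The radical of the triangle form is cyclic of order N, so d^2 * N = N^3. *)
Lemma triangle_irreducible_dim (W : vectType F) (r : triangle_rep q W) :
  irreducible_rep r -> \dim {:W} = N.
Proof.
move=> irr; have [x [x0 rX]] := irreducible_weights qN irr.
have := torus_irreducible_dim triangle_sigmaN qN x0 rX oddN irr.
rewrite card_triangle_radical card_ord [(N ^ 3)%N]expnSr => /eqP.
by rewrite eqn_pmul2r // eqn_exp2r // => /eqP.
Qed.

Lemma local_dim : \dim {:V} = (N ^ m)%N.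
Proof.
have [V_ [rho_ [tau [irr tauP _]]]] := rho_local.
by apply: (tensor_dim tauP) => f; apply: triangle_irreducible_dim (irr f).
Qed.

(** The generator attached to the side a acts on the factor of V given by the
    face of a. It need not commute with the X_e, but it does so up to a power
    of q that only involves the two other sides of that face. *)
Lemma local_side_op (a : side m) : exists2 Y : 'End(V), lker Y == 0%VS &
  forall k : 'I_n -> nat, (Y \o rho (weyln q (fock lam) k))%VF
    = q ^ (2 * ((k (edge lam (next_side a)))%:Z
                - (k (edge lam (prev_side a)))%:Z))
      *: (rho (weyln q (fock lam) k) \o Y)%VF.
Proof.
have [V_ [rho_ [tau [irr tauP rhoE]]]] := rho_local; have [tauM _] := tauP.
case: a => f i.
have [Y YE] := factor_op_exists tauP (rho_ f (cfX q triangle_sigma i)).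
have [Y' Y'E] := factor_op_exists tauP (rho_ f (cfXV q triangle_sigma i)).
exists Y.
  apply: (@lker0_left_inverse _ _ _ Y'); apply: (tensor_ext tauP) => v.
  rewrite comp_lfunE YE Y'E id_lfunE dfwith_in dfwith_idem -comp_lfunE -repM.
  by rewrite cfXV_X rep1 id_lfunE dfwith_id.
pose c e : int :=
  (edge lam (f, ordS i) == e)%:Z - (edge lam (f, ord_pred i) == e)%:Z.
have YX e : (Y \o rho (cfX q (fock lam) e))%VF
    = q ^ (2 * c e) *: (rho (cfX q (fock lam) e) \o Y)%VF.
  apply: (tensor_ext tauP) => v.
  rewrite comp_lfunE rhoE YE scale_lfunE comp_lfunE YE rhoE.
  have comm :
      (rho_ f (cfX q triangle_sigma i) \o rho_ f (iota_factor lam q e f))%VF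
      = q ^ (2 * c e) *: (rho_ f (iota_factor lam q e f)
                            \o rho_ f (cfX q triangle_sigma i))%VF.
    rewrite -!repM -repZ; congr (rho_ f _).
    rewrite -weyln_gen /iota_factor.
    rewrite (weyln_comm q0 triangle_sigmaN _
      (fun l => (edge lam (f, l) == e) : nat)).
    rewrite sform_gen; congr (q ^ (2 * _) *: _).
    rewrite /c -(triangle_sum (fun l => (edge lam (f, l) == e)%:Z)).
    by apply: eq_bigr => l _; rewrite mulrzz.
  rewrite -comp_lfunE comm scale_lfunE (multilinearZ tauM).
  congr (_ *: tau _); apply: functional_extensionality_dep => f'.
  have [<-|ff'] := eqVneq f f'; first by rewrite !dfwith_in comp_lfunE.
  by rewrite !dfwith_out.
move=> k; rewrite (qcomm_weyln q0 YX); congr (q ^ _ *: _).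
have pick e0 : \sum_e (k e)%:Z * (e0 == e)%:Z = (k e0)%:Z.
  rewrite (bigD1 e0) //= eqxx mulr1 big1 ?addr0 // => e.
  by rewrite eq_sym => /negPf ->; rewrite mulr0.
rewrite -!pick -sumrB mulr_sumr; apply: eq_bigr => e _.
by rewrite mulrCA mulrBr.
Qed.

End LocalRepresentation.

(** * Puncture invariants *)

Section CentralElements.
Variables (g s m n : nat) (lam : ideal_triangulation g s m n).
Variables (F : fieldType) (q : F).
Hypothesis q0 : q != 0.
Local Notation weyln := (weyln q (fock lam)).
Local Notation sform := (sform (fock lam)).
Local Notation H := (cfH lam q).
Local Notation P := (cfP lam q).

(** The natural number version of [loop_sum], used for exponents. *)
Definition multiloop (w : 'I_s -> nat) (e : 'I_n) : nat :=
  (\sum_v w v * punct_mult lam v e)%N.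

Lemma natmul_multiloop (Z : zmodType) (z : Z) w e :
  z *+ multiloop w e = loop_sum lam (fun v => z *+ w v) e.
Proof.
rewrite /multiloop -sumrMnr; apply: eq_bigr => v _; exact: mulrnA.
Qed.

Lemma sform_multiloop l w : sform l (multiloop w) = 0.
Proof.
rewrite sformE big1 // => i _; apply/eqP; rewrite mulf_eq0; apply/orP; right.
rewrite -[X in _ == X](loop_sum_central lam (fun v => 1 *+ w v : int) i).
by apply/eqP/eq_bigr => j _; rewrite -natmul_multiloop mulrzz natz.
Qed.

Lemma sform_const l t : sform l (fun=> t) = 0.
Proof.
rewrite sformE big1 // => i _; apply/eqP; rewrite mulf_eq0; apply/orP; right.
have := fock_sum lam (fun=> t%:Z) i.
rewrite [RHS]big1 => [E|a _]; last by rewrite /= subrr.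
by rewrite -[X in _ == X]E; apply/eqP/eq_bigr => j _; rewrite mulrzz.
Qed.

Lemma weyln_add_central k l :
  sform k l = 0 -> weyln k * weyln l = weyln (fun i => k i + l i)%N.
Proof.
by move=> kl0; rewrite weylnM //; [rewrite kl0 expr0z scale1r | exact: fockN].
Qed.

Lemma weyln_multiloop_comm k w :
  weyln k * weyln (multiloop w) = weyln (multiloop w) * weyln k.
Proof.
rewrite weyln_comm //; last exact: fockN.
by rewrite sform_multiloop mulr0 expr0z scale1r.
Qed.

Lemma multiloop1 v : multiloop (fun u => u == v : nat) = punct_mult lam v.
Proof.
apply/funext => e; rewrite /multiloop (bigD1 v) //= eqxx mul1n.
by rewrite big1 ?addn0 // => u /negPf ->.
Qed.

Lemma cfPX v k : P v ^+ k = weyln (fun e => k * punct_mult lam v e)%N.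
Proof.
elim: k => [|k IHk]; first by rewrite expr0 weyln0.
rewrite exprSr IHk -[P v]/(weyln (punct_mult lam v)) weyln_add_central.
  by apply: eq_weyln => e; rewrite mulSn addnC.
by rewrite -multiloop1 sform_multiloop.
Qed.

Lemma weyln_multiloop w : weyln (multiloop w) = \prod_v P v ^+ w v.
Proof.
have -> : multiloop w
    = multiloop (fun u => \sum_(v <- index_enum 'I_s) (u == v) * w v)%N.
  apply/funext => e; apply: eq_bigr => u _; rewrite (bigD1 u) //= eqxx mul1n.
  by rewrite big1 ?addn0 // => v; rewrite eq_sym => /negPf ->.
elim: (index_enum _) => [|v r IHr].
  rewrite big_nil -(weyln0 q (fock lam)); apply: eq_weyln => e.
  by rewrite /multiloop big1 // => u _; rewrite big_nil.
rewrite big_cons -IHr cfPX weyln_add_central ?sform_multiloop //.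
apply: eq_weyln => e.
rewrite -(multiloop1 v) /multiloop big_distrr -big_split /=.
by apply: eq_bigr => u _; rewrite big_cons mulnDl mulnCA mulnA.
Qed.

Lemma cfHX t : H ^+ t = weyln (fun=> t).
Proof.
elim: t => [|t IHt]; first by rewrite expr0 weyln0.
rewrite exprSr IHt -[H]/(weyln (fun=> 1%N)) weyln_add_central ?sform_const //.
by apply: eq_weyln => e; rewrite addn1.
Qed.

Lemma weyln_multiloop_const t : weyln (multiloop (fun=> t)) = H ^+ (2 * t).
Proof.
rewrite cfHX; apply: eq_weyln => e.
by rewrite /multiloop -big_distrr sum_punct_mult mulnC.
Qed.

End CentralElements.

(** [loop_sum_constant] over the integers modulo N. *)
Lemma multiloop_constant g s m n (lam : ideal_triangulation g s m n) N'
    (w : 'I_s -> 'I_N'.+1) : odd N'.+1 ->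
  (forall a, (N'.+1%:Z %| (multiloop lam w (edge lam (next_side a)))%:Z
       - (multiloop lam w (edge lam (prev_side a)))%:Z)%Z) ->
  forall v v', w v = w v'.
Proof.
move=> oddN wP.
apply: (loop_sum_constant (lam := lam) (fun z => Zp_halfK z oddN)) => a.
have loopE e : loop_sum lam w e = inZp 1 *+ multiloop lam w e.
  rewrite natmul_multiloop; apply: eq_bigr => v _; congr (_ *+ _).
  by rewrite Zp_mulrn; apply: val_inj; rewrite /= modnMml mul1n modn_small.
apply/eqP; rewrite -subr_eq0 !loopE !pmulrn -mulrzBr Zp_mulrz_eq0.
exact: wP.
Qed.

Section ScalarActions.
Variables (F : fieldType) (I : Type).
Variable rels : pres_expr F I -> pres_expr F I -> Prop.
Variables (V : vectType F) (rho : representation rels V).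
Hypothesis V0 : (0 < \dim {:V})%N.

Lemma acts_by_inj a z z' : acts_by rho a z -> acts_by rho a z' -> z = z'.
Proof.
rewrite /acts_by => -> /eqP; rewrite -subr_eq0 -scalerBl scaler_eq0 subr_eq0.
case/orP => [/eqP // | /eqP id0]; move: V0; rewrite lt0n dimv_eq0.
by rewrite -[fullv]lim1g id0 lim0g eqxx.
Qed.
End ScalarActions.

Section Decomposition.
Variables (g s m n : nat) (lam : ideal_triangulation g s m n).
Variables (F : numClosedFieldType) (N' : nat) (q : F).
Local Notation N := N'.+1.
Hypothesis qN : N.-primitive_root q.
Hypothesis oddN : odd N.
Local Notation weyln := (weyln q (fock lam)).
Let q0 : q != 0 := prim_root_neq0 qN.
Let sigmaN := fockN lam.

Section OneRepresentation.
Variables (V : vectType F) (rho : cf_rep lam q V) (x : 'I_n -> F).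
Hypothesis x0 : forall e, x e != 0.
Hypothesis rhoX : edge_weights N rho x.

Lemma puncture_scalar : irreducible_rep rho ->
  exists p : 'I_s -> F, puncture_root lam N x p /\
    forall v, acts_by rho (cfP lam q v) (p v).
Proof.
move=> irr.
have /fin_all_exists[p pE] : forall v, exists z, acts_by rho (cfP lam q v) z.
  move=> v; apply: (schur_rep (g := rho (cfP lam q v)) irr).
  apply: (torus_comm sigmaN qN x0 rhoX) => k.
  by rewrite -!repM; congr (rho _);
    rewrite -[cfP _ _ _]/(weyln (punct_mult lam v)) -multiloop1;
    rewrite weyln_multiloop_comm.
exists p; split=> // v; have V0 := dim_irreducible_gt0 irr.
apply: (acts_by_inj V0 (repX_scalar N (pE v))).
rewrite cfPX //; exact: (rep_weyln_scale qN rhoX).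
Qed.

(** Here d^2 * N^s = N^n, and n = 2(3g - 3 + s) + s. *)
Lemma irreducible_dim_surface : (0 < g)%N -> irreducible_rep rho ->
  (\dim {:V} = N ^ (s + 3 * g - 3))%N.
Proof.
move=> g_gt0 irr.
have := torus_irreducible_dim sigmaN qN x0 rhoX oddN irr.
rewrite (card_fock_radical lam (fun z => Zp_halfK z oddN)) card_ord.
have := card_edges lam; have := euler lam => eul card.
(* 3 m = 2 n, and s - n + m = 2 - 2 g *)
have nE : n = ((s + 3 * g - 3) * 2 + s)%N by lia.
rewrite [X in _ = (N ^ X)%N]nE expnD expnM => /eqP.
by rewrite eqn_pmul2r ?expn_gt0 // eqn_exp2r // => /eqP.
Qed.

End OneRepresentation.
End Decomposition.

(** * Multiplicities *)

Lemma sum_unity_root (F : fieldType) (r : F) k : r ^+ k = 1 ->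
  \sum_(t < k) r ^+ t = if r == 1 then k%:R else 0.
Proof.
move=> rk; case: eqP => [->|/eqP r1].
  by under eq_bigr do rewrite expr1n; rewrite sumr_const card_ord.
have /eqP := subrX1 r k; rewrite rk subrr eq_sym mulf_eq0 subr_eq0 (negPf r1).
by move/eqP.
Qed.

Section DirectSums.
Variables (F : fieldType) (V : vectType F) (I : finType) (W : I -> {vspace V}).
Hypothesis sumW : (\sum_i W i)%VS = fullv.
Hypothesis dimW : (\sum_i \dim (W i) = \dim {:V})%N.

Lemma dim_partial_sum (P : pred I) :
  (\dim (\sum_(i | P i) W i) = \sum_(i | P i) \dim (W i))%N.
Proof.
apply/eqP; rewrite eqn_leq dimv_leq_sum /=.
have leC : (\dim (\sum_(i | ~~ P i) W i) <= \sum_(i | ~~ P i) \dim (W i))%N.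
  exact: dimv_leq_sum.
have dimID : (\sum_(i | P i) \dim (W i) + \sum_(i | ~~ P i) \dim (W i))%N
    = \dim {:V} by rewrite -dimW [RHS](bigID P).
rewrite -(leq_add2r (\sum_(i | ~~ P i) \dim (W i))%N) dimID -sumW.
rewrite (bigID P) /=; apply: leq_trans (leq_add (leqnn _) leC).
by rewrite -dimv_sum_cap leq_addr.
Qed.

(** Such an f is the projection onto the sum of the W i with P i. *)
Lemma trace_indicator (P : pred I) (f : 'End(V)) :
    (forall i u, u \in W i -> f u = if P i then u else 0) ->
  lftrace f = (\sum_(i | P i) \dim (W i))%:R.
Proof.
move=> fW; pose E := (\sum_(i | P i) W i)%VS.
have fE : (E <= fixedSpace f)%VS.
  apply/subv_sumP => i Pi; apply/subvP => u Wu.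
  by apply/fixedSpaceP; rewrite (fW i) // Pi.
have limfE : limg f = E.
  apply/eqP; rewrite eqEsubv; apply/andP; split.
    rewrite -sumW limg_sum; apply/subv_sumP => i _.
    apply/subvP => _ /memv_imgP[u Wu ->]; rewrite (fW i) //.
    case: ifP => Pi; last exact: mem0v.
    by apply: subvP Wu; apply: (sumv_sup i).
  by rewrite -(fixedSpace_limg fE) limgS ?subvf.
rewrite lftrace_idempotent ?limfE ?dim_partial_sum //.
apply/lfunP => u; rewrite comp_lfunE; apply/fixedSpaceP.
by apply: subvP fE _ _; rewrite -limfE memv_img ?memvf.
Qed.
End DirectSums.

Section Multiplicity.
Variables (g s m n : nat) (lam : ideal_triangulation g s m n).
Variables (F : numClosedFieldType) (N' : nat) (q : F).
Local Notation N := N'.+1.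
Hypothesis qN : N.-primitive_root q.
Hypothesis oddN : odd N.
Local Notation weyln := (weyln q (fock lam)).
Let q0 : q != 0 := prim_root_neq0 qN.
Variables (V : vectType F) (rho : cf_rep lam q V) (x : 'I_n -> F) (c : F).
Hypothesis x0 : forall e, x e != 0.
Hypothesis rho_local : local_rep rho.
Hypothesis rhoH : acts_by rho (cfH lam q) c.
Variable v0 : 'I_s.

(** If w is not constant, some side operator commutes with the monomial only up
    to a factor different from 1; if w is constant, the monomial is a power
    of H. *)
Lemma trace_multiloop (w : {ffun 'I_s -> 'I_N}) :
  lftrace (rho (weyln (multiloop lam (fun v => w v))))
  = if w == [ffun=> w v0] then c ^+ (2 * w v0) * (N ^ m)%:R else 0.
Proof.
case: eqP => [wE|w_neq].
  have -> : weyln (multiloop lam (fun v => w v)) = cfH lam q ^+ (2 * w v0).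
    rewrite -weyln_multiloop_const //; apply: eq_weyln => e.
    by apply: eq_bigr => v _; rewrite wE !ffunE.
  rewrite (repX_scalar _ rhoH) linearZ /= lftrace1.
  by rewrite (local_dim qN oddN rho_local).
pose k e := multiloop lam (fun v => w v) e.
have [a Na] : exists a, ~~ (N%:Z %| (k (edge lam (next_side a)))%:Z
     - (k (edge lam (prev_side a)))%:Z)%Z.
  apply/existsP; rewrite -negb_forall; apply/negP => /forallP wP.
  apply: w_neq; apply/ffunP => v; rewrite ffunE.
  exact: multiloop_constant wP _ _.
have [Y Y0 YE] := local_side_op qN rho_local a.
apply: (lftrace_qcomm Y0 (YE _)).
by rewrite (prim_root_exprz2 _ oddN qN).
Qed.

Variable p0 : 'I_s -> F.
Hypothesis p0_root : puncture_root lam N x p0.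
Hypothesis p0_prod : \prod_v p0 v = c ^+ 2.

Lemma puncture_root_neq0 p v : puncture_root lam N x p -> p v != 0.
Proof.
move=> p_root; have : p v ^+ N != 0.
  by rewrite p_root; apply/prodf_neq0 => e _; rewrite expf_neq0.
by rewrite expf_eq0.
Qed.

(** The projector onto the joint eigenspace of the P_v for the eigenvalues
    p0 v. *)
Definition puncture_projector : 'End(V) := (N ^ s)%:R^-1 *:
  \sum_(w : {ffun 'I_s -> 'I_N}) (\prod_v p0 v ^- w v)
    *: rho (weyln (multiloop lam (fun v => w v))).

Lemma trace_puncture_projector :
  lftrace puncture_projector = (N ^ s)%:R^-1 * (N ^ m.+1)%:R.
Proof.
rewrite linearZ linear_sum /=; congr (_ * _).
under eq_bigr => w _ do rewrite linearZ /= trace_multiloop.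
(* only the N constant exponents w contribute, each of them N^m *)
rewrite (bigID (fun w : {ffun 'I_s -> 'I_N} => w == [ffun=> w v0])) /=.
rewrite [X in _ + X]big1 ?addr0 => [|w /negPf ->]; last exact: mulr0.
rewrite (reindex_onto (fun t : 'I_N => [ffun=> t])
    (fun w : {ffun 'I_s -> 'I_N} => w v0));
  last by move=> w /eqP ->; rewrite !ffunE.
rewrite (eq_bigl xpredT) => [|t]; last by rewrite !ffunE !eqxx.
rewrite (eq_bigr (fun=> (N ^ m)%:R)) => [|t _].
  by rewrite sumr_const card_ord expnSr natrM mulr_natr.
rewrite ffunE eqxx mulrA; under eq_bigr do rewrite ffunE.
rewrite prodfV prodrXl p0_prod -exprM mulVf ?mul1r //.
rewrite expf_neq0 //; apply: contraNneq (puncture_root_neq0 v0 p0_root) => c0.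
have /eqP := p0_prod; rewrite c0 expr0n /= => /prodf_eq0[v _ /eqP pv].
by case/negP: (puncture_root_neq0 v p0_root); rewrite pv.
Qed.

(** Orthogonality of the characters of (Z/N)^s: each p v / p0 v is an N-th root
    of unity. *)
Lemma puncture_projectorE p u : puncture_root lam N x p ->
    (forall w : 'I_s -> nat, rho (weyln (multiloop lam w)) u
       = (\prod_v p v ^+ w v) *: u) ->
  puncture_projector u = if [forall v, p v == p0 v] then u else 0.
Proof.
move=> p_root pu; rewrite scale_lfunE sum_lfunE.
rewrite (eq_bigr (fun w : {ffun 'I_s -> 'I_N} =>
  (\prod_v (p v / p0 v) ^+ w v) *: u)) => [|w _]; last first.
  rewrite scale_lfunE pu scalerA -big_split /=; congr (_ *: u).
  by apply: eq_bigr => v _; rewrite expr_div_n mulrC.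
rewrite -scaler_suml -(bigA_distr_bigA (fun v (t : 'I_N) => (p v / p0 v) ^+ t)).
have NF : (N ^ s)%:R != 0 :> F by rewrite pnatr_eq0 expn_eq0.
have termE v : \sum_(t < N) (p v / p0 v) ^+ t
    = if p v == p0 v then N%:R else 0.
  have p0v := puncture_root_neq0 v p0_root.
  rewrite sum_unity_root ?expr_div_n ?p_root ?p0_root ?divff //.
    by rewrite -(inj_eq (mulIf p0v)) divfK // mul1r.
  by rewrite -p0_root expf_neq0.
rewrite (eq_bigr _ (fun v _ => termE v)) scalerA.
case: ifPn => [/forallP pp0|].
  rewrite (eq_bigr (fun=> N%:R)) => [|v _]; last by rewrite pp0.
  by rewrite prodr_const card_ord -natrX mulVf // scale1r.
rewrite negb_forall => /existsP[v /negPf pv].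
by rewrite (bigD1 v) //= pv mul0r mulr0 scale0r.
Qed.

End Multiplicity.

(** * Decomposition of local representations *)

(** The complex numbers enter through algebraic closedness (Schur's lemma) and
    characteristic 0 (averages and counting by traces). *)
Theorem local_representation_decomposition
    (F : numClosedFieldType) (g s m n : nat)
    (lam : ideal_triangulation g s m n)
    (N : nat) (q : F) (V : vectType F)
    (rho : cf_rep lam q V)
    (x : 'I_n -> F) (c : F)
    (g_gt0 : (0 < g)%N) (s_gt0 : (0 < s)%N)
    (N_odd : odd N) (q_prim : N.-primitive_root q)
    (x_neq0 : forall e, x e != 0)
    (rho_local : classified_local N rho x c) :
  exists (I : finType) (W : I -> {vspace V})
         (rhoI : forall i, cf_rep lam q (subvs_of (W i)))
         (p : I -> 'I_s -> F),
    [/\ (\sum_i W i)%VS = fullv /\ directv (\sum_i W i),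
        forall i, is_restriction rho (rhoI i),
        forall i, puncture_root lam N x (p i) /\
                  classified_irreducible N (rhoI i) x (p i) c &
        forall p0 : 'I_s -> F,
          puncture_root lam N x p0 -> \prod_(v < s) p0 v = c ^+ 2 ->
          #|[set i : I | [forall v, p i v == p0 v]]| = (N ^ g)%N].
Proof.
case: N q_prim N_odd rho_local => // N' qN oddN [rho_local rhoX rhoH].
have q0 := prim_root_neq0 qN; have sigmaN := fockN lam.
have sub_full : subrep rho fullv by move=> a; apply: subvf.
have [sW [simpleW sumW dimW]] :=
  semisimple (torus_complemented sigmaN qN x_neq0 rhoX) sub_full.
pose W (i : 'I_(size sW)) := nth 0%VS sW i.
have simple i : simple_subrep rho (W i) by apply/simpleW/mem_nth.
have sub i : subrep rho (W i) by case: (simple i).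
pose rhoI i := restriction (sub i).
have irr i : irreducible_rep (rhoI i) by apply: restriction_irreducible.
have rhoIX i : edge_weights N'.+1 (rhoI i) x.
  by move=> e; apply: restriction_acts_by.
have /fin_all_exists[p pP] i : exists p : 'I_s -> F,
    puncture_root lam N'.+1 x p
    /\ forall v, acts_by (rhoI i) (cfP lam q v) (p v).
  by have := puncture_scalar qN x_neq0 (rhoIX i) (irr i).
have {}sumW : (\sum_i W i)%VS = fullv by rewrite -sumW (big_nth 0%VS) big_mkord.
have {}dimW : (\sum_i \dim (W i) = \dim {:V})%N.
  by rewrite -dimW (big_nth 0%VS) big_mkord.
exists 'I_(size sW), W, rhoI, p; split.
- by split=> //; rewrite directvE /= sumW dimW.
- by move=> i; apply: restriction_is_restriction.
- move=> i; have [p_root pE] := pP i; split=> //; split=> //.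
  exact: restriction_acts_by.
move=> p0 p0_root p0_prod; pose v0 := Ordinal s_gt0.
have projE i u : u \in W i -> puncture_projector N' rho p0 u
    = if [forall v, p i v == p0 v] then u else 0.
  move=> Wu; have [p_root pE] := pP i.
  apply: (puncture_projectorE x_neq0 p0_root p_root) => w.
  apply: (acts_by_on_subrep (sW := sub i)) Wu.
  rewrite weyln_multiloop //.
  by apply: rep_prod_scalar => v; apply: repX_scalar.
have := trace_indicator sumW dimW projE.
rewrite (trace_puncture_projector qN oddN x_neq0 rho_local rhoH v0 p0_root
  p0_prod).
have dimE i : \dim (W i) = (N'.+1 ^ (s + 3 * g - 3))%N.
  rewrite -dim_subvs.
  by rewrite (irreducible_dim_surface qN oddN x_neq0 (rhoIX i) g_gt0).
rewrite (eq_bigr _ (fun i _ => dimE i)) sum_nat_const -cardsE.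
have Ns0 : (N'.+1 ^ s)%:R != 0 :> F by rewrite pnatr_eq0 expn_eq0.
move/(canRL (mulVKf Ns0)) => /eqP; rewrite -natrM eqr_nat.
have eul := euler lam; have card := card_edges lam.
(* N^(m+1) = #|good summands| * N^(3g-3+s) * N^s, and m + 1 = 4g - 3 + 2s *)
have -> : m.+1 = (g + (s + 3 * g - 3) + s)%N by lia.
rewrite [(N'.+1 ^ s * _)%N]mulnC 2!expnD.
by rewrite eqn_pmul2r ?expn_gt0 // eqn_pmul2r ?expn_gt0 // => /eqP ->.
Qed.

Theorem mainTheorem1 (R : realType) (g s m n : nat)
    (lam : ideal_triangulation g s m n)
    (N : nat) (q : R[i]) (V : vectType R[i])
    (rho : cf_rep lam q V)
    (x : 'I_n -> R[i]) (c : R[i])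
    (g_gt0 : (0 < g)%N) (s_gt0 : (0 < s)%N)
    (N_odd : odd N) (q_prim : N.-primitive_root q)
    (x_neq0 : forall e, x e != 0) (c_root : c ^+ N = \prod_(e < n) x e)
    (rho_local : classified_local N rho x c) :
  exists (I : finType) (W : I -> {vspace V})
         (rhoI : forall i, cf_rep lam q (subvs_of (W i)))
         (p : I -> 'I_s -> R[i]),
    [/\ (\sum_i W i)%VS = fullv /\ directv (\sum_i W i),
        forall i, is_restriction rho (rhoI i),
        forall i, puncture_root lam N x (p i) /\
                  classified_irreducible N (rhoI i) x (p i) c &
        forall p0 : 'I_s -> R[i],
          puncture_root lam N x p0 -> \prod_(v < s) p0 v = c ^+ 2 ->
          #|[set i : I | [forall v, p i v == p0 v]]| = (N ^ g)%N].
Proof.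
exact: (@local_representation_decomposition R[i] g s m n lam N q V rho x c
  g_gt0 s_gt0 N_odd q_prim x_neq0 rho_local).
Qed.
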